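(* Let $\kappa$ be an infinite cardinal less than the continuum, and assume $BP(\kappa)$. Let $X$ be a connected, locally path connected $\kappa$-Polish space. Then the fundamental group $\pi_1(X)$ has cardinality at most $\kappa$ or cardinality equal to the continuum.
   Context: A topological space is $\kappa$-separable if it has a dense subset of cardinality at most $\kappa$, and $\kappa$-Polish if it is completely metrizable and $\kappa$-separable. If $Y$ is a Polish space (separable, completely metrizable), a set $A\subseteq Y$ is $\kappa$-Suslin if there is a closed set $D\subseteq Y\times\kappa^{\mathbb{N}}$ (with $\kappa$ discrete and $\kappa^{\mathbb{N}}$ the product topology) whose projection to $Y$ is $A$. A set $A\subseteq Y$ has the property of Baire if there is an open $O\subseteq Y$ with $(A\cup O)\setminus(A\cap O)$ meager. $BP(\kappa)$ is the statement that every $\kappa$-Suslin subset of every Polish space has the property of Baire. *)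

(* Defs.v *)
From Stdlib Require Import Reals.
Open Scope R_scope.

Record topology (T : Type) := {
  is_open : (T -> Prop) -> Prop;
  open_full : is_open (fun _ => True);
  open_inter : forall U V, is_open U -> is_open V -> is_open (fun x => U x /\ V x);
  open_union : forall F : (T -> Prop) -> Prop,
      (forall U, F U -> is_open U) -> is_open (fun x => exists U, F U /\ U x)
}.
Arguments is_open {T} _ _.

Definition is_closed {T} (tau : topology T) (C : T -> Prop) : Prop :=
  is_open tau (fun x => ~ C x).

Definition interior {T} (tau : topology T) (A : T -> Prop) : T -> Prop :=
  fun x => exists U, is_open tau U /\ U x /\ (forall y, U y -> A y).

Definition closure {T} (tau : topology T) (A : T -> Prop) : T -> Prop :=
  fun x => forall U, is_open tau U -> U x -> exists y, U y /\ A y.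

Definition dense {T} (tau : topology T) (D : T -> Prop) : Prop :=
  forall x, closure tau D x.

Definition card_le_pred {T K : Type} (D : T -> Prop) : Prop :=
  exists f : T -> K, forall x y, D x -> D y -> f x = f y -> x = y.

Definition is_metric {T} (d : T -> T -> R) : Prop :=
  (forall x y, 0 <= d x y) /\ (forall x y, d x y = 0 <-> x = y) /\
  (forall x y, d x y = d y x) /\ (forall x y z, d x z <= d x y + d y z).

Definition metric_open {T} (d : T -> T -> R) (U : T -> Prop) : Prop :=
  forall x, U x -> exists e, 0 < e /\ forall y, d x y < e -> U y.

Definition metric_complete {T} (d : T -> T -> R) : Prop :=
  forall u : nat -> T,
    (forall e, 0 < e -> exists N, forall m n, (N <= m)%nat -> (N <= n)%nat -> d (u m) (u n) < e) ->
    exists l, forall e, 0 < e -> exists N, forall n, (N <= n)%nat -> d (u n) l < e.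

Definition completely_metrizable {T} (tau : topology T) : Prop :=
  exists d : T -> T -> R, is_metric d /\ metric_complete d /\
    (forall U, is_open tau U <-> metric_open d U).

Definition k_separable (K : Type) {T} (tau : topology T) : Prop :=
  exists D : T -> Prop, dense tau D /\ @card_le_pred T K D.

Definition k_polish (K : Type) {T} (tau : topology T) : Prop :=
  completely_metrizable tau /\ k_separable K tau.

Definition separable {T} (tau : topology T) : Prop := k_separable nat tau.

Definition polish {T} (tau : topology T) : Prop :=
  completely_metrizable tau /\ separable tau.

(* Open sets of Y x K^N, with K discrete and K^N the product topology *)
Definition prod_baire_open {Y K : Type} (tau : topology Y)
    (O : Y -> (nat -> K) -> Prop) : Prop :=
  forall y s, O y s -> exists U n, is_open tau U /\ U y /\
    forall y' s', U y' -> (forall i, (i < n)%nat -> s' i = s i) -> O y' s'.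

Definition prod_baire_closed {Y K : Type} (tau : topology Y)
    (C : Y -> (nat -> K) -> Prop) : Prop :=
  prod_baire_open tau (fun y s => ~ C y s).

Definition k_suslin (K : Type) {Y} (tau : topology Y) (A : Y -> Prop) : Prop :=
  exists C : Y -> (nat -> K) -> Prop, prod_baire_closed tau C /\
    forall y, A y <-> exists s, C y s.

Definition nowhere_dense {T} (tau : topology T) (N : T -> Prop) : Prop :=
  forall x, ~ interior tau (closure tau N) x.

Definition meager {T} (tau : topology T) (M : T -> Prop) : Prop :=
  exists N : nat -> T -> Prop, (forall n, nowhere_dense tau (N n)) /\
    forall x, M x -> exists n, N n x.

Definition baire_property {T} (tau : topology T) (A : T -> Prop) : Prop :=
  exists O, is_open tau O /\
    meager tau (fun x => (A x \/ O x) /\ ~ (A x /\ O x)).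

Definition BP (K : Type) : Prop :=
  forall (Y : Type) (tau : topology Y), polish tau ->
    forall A : Y -> Prop, k_suslin K tau A -> baire_property tau A.

Definition connected {T} (tau : topology T) : Prop :=
  forall U V, is_open tau U -> is_open tau V ->
    (forall x, U x \/ V x) -> (forall x, ~ (U x /\ V x)) ->
    (forall x, ~ U x) \/ (forall x, ~ V x).

Definition cont_on_I {T} (tau : topology T) (g : R -> T) : Prop :=
  forall t, 0 <= t <= 1 -> forall U, is_open tau U -> U (g t) ->
    exists del, 0 < del /\ forall s, 0 <= s <= 1 -> Rabs (s - t) < del -> U (g s).

Definition cont_on_I2 {T} (tau : topology T) (H : R -> R -> T) : Prop :=
  forall t u, 0 <= t <= 1 -> 0 <= u <= 1 -> forall U, is_open tau U -> U (H t u) ->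
    exists del, 0 < del /\ forall s v, 0 <= s <= 1 -> 0 <= v <= 1 ->
      Rabs (s - t) < del -> Rabs (v - u) < del -> U (H s v).

Definition is_path {T} (tau : topology T) (g : R -> T) (a b : T) : Prop :=
  cont_on_I tau g /\ g 0 = a /\ g 1 = b.

Definition locally_path_connected {T} (tau : topology T) : Prop :=
  forall x U, is_open tau U -> U x ->
    exists V, is_open tau V /\ V x /\ (forall y, V y -> U y) /\
      forall a b, V a -> V b -> exists g, is_path tau g a b /\
        forall t, 0 <= t <= 1 -> V (g t).

Definition is_loop {T} (tau : topology T) (x0 : T) (g : R -> T) : Prop :=
  is_path tau g x0 x0.

Definition loop_homotopic {T} (tau : topology T) (x0 : T) (g h : R -> T) : Prop :=
  exists H : R -> R -> T, cont_on_I2 tau H /\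
    (forall s, 0 <= s <= 1 -> H 0 s = g s /\ H 1 s = h s) /\
    (forall t, 0 <= t <= 1 -> H t 0 = x0 /\ H t 1 = x0).

Definition pi1_card_le (K : Type) {T} (tau : topology T) (x0 : T) : Prop :=
  exists f : (R -> T) -> K, forall g h, is_loop tau x0 g -> is_loop tau x0 h ->
    (loop_homotopic tau x0 g h <-> f g = f h).

Definition pi1_card_continuum {T} (tau : topology T) (x0 : T) : Prop :=
  exists f : (R -> T) -> R,
    (forall g h, is_loop tau x0 g -> is_loop tau x0 h ->
      (loop_homotopic tau x0 g h <-> f g = f h)) /\
    (forall r, exists g, is_loop tau x0 g /\ f g = r).

(* Main.v *)
(** Suppose first that every point has a neighbourhood whose loops based there are null-homotopic in the
    space.  Then [K]-many open sets in which homotopy of paths is decided by the endpoints cover the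
    space, and a loop is determined up to homotopy by a finite chain of such sets together with a marking of
    the path components through which it passes from one to the next.  This gives at most as many
    classes as there are finite lists over [K], hence at most [K] many.

    Otherwise some point is the base of essential loops [g_n] that shrink to it.  For a binary sequence [a]
    let [L a] be the infinite concatenation of those [g_n] with [a n = 1].  If [a] and [b] differ in exactly
    one coordinate, cancellation shows that [L a] and [L b] are not homotopic.  Homotopies are
    coded by elements of [K^N], so the relation "[L a] is homotopic to [L b]" is [K]-Suslin and has the
    property of Baire.  Being an equivalence relation with that one-coordinate property it is
    meager, and Mycielski's theorem provides continuum many inequivalent sequences. *)

Require Import Defs.
From Stdlib Require Import Reals Lra Lia List Arith ZArith.
From Stdlib Require Cantor.
From Stdlib Require Import Classical ClassicalEpsilon FunctionalExtensionality PropExtensionality.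
From Stdlib Require Import Setoid Morphisms.
From Coquelicot Require Compactness.
From mathcomp Require classical_sets.
Import ListNotations.
Open Scope R_scope.

(** * Cardinal arithmetic *)

(** In the first case everything rests on an injection of [list K] into [K], obtained from Zorn's
    lemma. It is used twice: to index the balls of the cover by [K], and to pack a whole chain of
    sets and markers into one element of [K]. In the second case the obstacle is to present homotopy
    as the projection of a closed set. Only the points of a dense set can be named by elements of
    [K], so a code consists of a modulus of uniform continuity and of approximations, of prescribed
    accuracy, at countably many grid points; completeness of the metric recovers the map. Closedness
    in the binary sequences holds because at a fixed time an infinite concatenation reads only
    finitely many digits. Mycielski's theorem gives at least continuum many classes. There are no
    more, since a loop is determined by its values at rational times and each value by a sequence of
    approximations from the dense set; the Schroeder-Bernstein theorem then gives equality. *)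

Definition inj {A B : Type} (f : A -> B) : Prop := forall x y, f x = f y -> x = y.

Lemma inj_left_inverse {A B : Type} (f : A -> B) (a0 : A) :
  inj f -> exists g : B -> A, forall a, g (f a) = a.
Proof.
  intros Hf.
  exists (fun b => epsilon (inhabits a0) (fun a => f a = b)).
  intros a. apply Hf. apply (epsilon_spec (inhabits a0) (fun a' => f a' = f a)).
  exists a; reflexivity.
Qed.

Lemma schroeder_bernstein {A B : Type} (f : A -> B) (g : B -> A) :
  inj f -> inj g -> exists h : A -> B, inj h /\ forall b, exists a, h a = b.
Proof.
  intros Hf Hg.
  (* Points whose backward chain under [g] and [f] stops in [A] outside the image of [g]. The
     bijection is [f] on [C] and the inverse of [g] off [C]. *)
  set (C := fun a => exists n a0, (forall b, g b <> a0) /\ a = Nat.iter n (fun x => g (f x)) a0).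
  assert (HC : forall a, ~ C a -> exists b, g b = a).
  { intros a Ha. apply NNPP; intros H. apply Ha. exists 0%nat, a. split; auto.
    intros b Hb; apply H; eauto. }
  assert (HS : forall a, C a -> C (g (f a))).
  { intros a (n & a0 & H0 & ->). exists (S n), a0. auto. }
  assert (Hh : forall a, exists b, (C a -> b = f a) /\ (~ C a -> g b = a)).
  { intros a. destruct (classic (C a)) as [Ca|Ca].
    - exists (f a). tauto.
    - destruct (HC a Ca) as [b Hb]. exists b. tauto. }
  destruct (choice _ Hh) as [h Hh']. exists h. split.
  - intros x y Hxy. destruct (Hh' x) as [X1 X2], (Hh' y) as [Y1 Y2].
    destruct (classic (C x)) as [Cx|Cx], (classic (C y)) as [Cy|Cy].
    + apply Hf. rewrite <- X1, <- Y1; auto.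
    + exfalso. apply Cy. rewrite <- (Y2 Cy), <- Hxy, (X1 Cx). auto.
    + exfalso. apply Cx. rewrite <- (X2 Cx), Hxy, (Y1 Cy). auto.
    + rewrite <- (X2 Cx), <- (Y2 Cy), Hxy. reflexivity.
  - intros b. destruct (classic (C (g b))) as [Cb|Cb].
    + destruct Cb as (n & a0 & H0 & E). destruct n as [|n].
      * destruct (H0 b E).
      * cbn in E. apply Hg in E. exists (Nat.iter n (fun x => g (f x)) a0).
        rewrite E. apply (proj1 (Hh' _)). exists n, a0. auto.
    + exists (g b). apply Hg. apply (proj2 (Hh' _)); auto.
Qed.

Lemma zorn_sets {T : Type} (P : (T -> Prop) -> Prop) :
  (forall F : (T -> Prop) -> Prop, (forall A, F A -> P A) ->
     (forall A B, F A -> F B -> (forall t, A t -> B t) \/ (forall t, B t -> A t)) ->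
     P (fun t => exists A, F A /\ A t)) ->
  exists A, P A /\ forall B, P B -> (forall t, A t -> B t) -> forall t, B t -> A t.
Proof.
  intros H.
  destruct (@classical_sets.Zorn_bigcup T P) as [A [PA HA]].
  - intros F FP Ft. specialize (H F FP Ft).
    replace (classical_sets.bigcup F (fun X => X)) with (fun t => exists A, F A /\ A t); auto.
    extensionality t. apply propositional_extensionality. split.
    + intros (A & FA & At). exists A; auto.
    + intros [A FA At]. exists A; auto.
  - exists A. split; auto. intros B PB AB t Bt. apply NNPP; intros At.
    apply (HA B); auto. split; [intros x; apply AB|]. intros BA. apply At, BA, Bt.
Qed.

(** Comparability of cardinals: a maximal partial bijection between [A] and [B] exhausts one of
    them, as otherwise an unmatched pair could be added. *)
Lemma injection_total {T : Type} (A B : T -> Prop) :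
  (exists f : T -> T, (forall x, A x -> B (f x)) /\ forall x y, A x -> A y -> f x = f y -> x = y)
  \/
  (exists f : T -> T, (forall x, B x -> A (f x)) /\ forall x y, B x -> B y -> f x = f y -> x = y).
Proof.
  set (P := fun S : T * T -> Prop =>
    (forall x y, S (x, y) -> A x /\ B y) /\
    (forall x y y', S (x, y) -> S (x, y') -> y = y') /\
    (forall x x' y, S (x, y) -> S (x', y) -> x = x')).
  destruct (zorn_sets P) as (S & (S1 & S2 & S3) & Smax).
  { intros F FP Fc. split; [|split].
    - intros x y (C & FC & HC). exact (proj1 (FP C FC) _ _ HC).
    - intros x y y' (C & FC & HC) (C' & FC' & HC').
      destruct (Fc C C' FC FC') as [I|I]; apply I in HC || apply I in HC'.
      + exact (proj1 (proj2 (FP C' FC')) x _ _ HC HC').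
      + exact (proj1 (proj2 (FP C FC)) x _ _ HC HC').
    - intros x x' y (C & FC & HC) (C' & FC' & HC').
      destruct (Fc C C' FC FC') as [I|I]; apply I in HC || apply I in HC'.
      + exact (proj2 (proj2 (FP C' FC')) _ _ _ HC HC').
      + exact (proj2 (proj2 (FP C FC)) _ _ _ HC HC'). }
  destruct (classic (forall x, A x -> exists y, S (x, y))) as [HA|HA].
  - left.
    assert (Hf : forall x, exists y, A x -> S (x, y)).
    { intros x. destruct (classic (A x)) as [Ax|Ax].
      - destruct (HA x Ax) as [y Hy]. exists y; auto.
      - exists x; tauto. }
    destruct (choice _ Hf) as [f Hf']. exists f. split.
    + intros x Ax. apply (S1 x (f x)); auto.
    + intros x y Ax Ay E. apply (S3 x y (f x)); auto. rewrite E; auto.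
  - right.
    apply not_all_ex_not in HA as [a Ha]. apply imply_to_and in Ha as [Aa Na].
    assert (HB : forall y, B y -> exists x, S (x, y)).
    { intros b Bb. apply NNPP; intros Nb. apply Na. exists b.
      apply (Smax (fun p => S p \/ p = (a, b))); auto.
      split; [|split].
      - intros x y [H|H]; [auto|injection H as -> ->; auto].
      - intros x y y' [H|H] [H'|H'].
        + eauto.
        + injection H' as -> ->. destruct Na; eauto.
        + injection H as -> ->. destruct Na; eauto.
        + congruence.
      - intros x x' y [H|H] [H'|H'].
        + eauto.
        + injection H' as -> ->. destruct Nb; eauto.
        + injection H as -> ->. destruct Nb; eauto.
        + congruence. }
    assert (Hf : forall y, exists x, B y -> S (x, y)).
    { intros y. destruct (classic (B y)) as [By|By].
      - destruct (HB y By) as [x Hx]. exists x; auto.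
      - exists y; tauto. }
    destruct (choice _ Hf) as [f Hf']. exists f. split.
    + intros y By. apply (S1 (f y) y); auto.
    + intros x y Bx By E. apply (S2 (f x) x y); auto. rewrite E; auto.
Qed.

Fixpoint list_nat_code (l : list nat) : nat :=
  match l with
  | [] => 0
  | x :: l => S (Cantor.to_nat (x, list_nat_code l))
  end.

Lemma list_nat_code_inj : inj list_nat_code.
Proof.
  intros l; induction l as [|x l IH]; intros [|y m] E; try discriminate; auto.
  apply Nat.succ_inj, (f_equal Cantor.of_nat) in E. rewrite !Cantor.cancel_of_to in E.
  injection E as -> E. f_equal; auto.
Qed.

Lemma map_inj {A B : Type} (f : A -> B) (P : A -> Prop) :
  (forall x y, P x -> P y -> f x = f y -> x = y) ->
  forall l m, (forall x, In x l -> P x) -> (forall x, In x m -> P x) -> map f l = map f m -> l = m.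
Proof.
  intros Hf l; induction l as [|x l IH]; intros [|y m] Hl Hm E; cbn in E; try discriminate; auto.
  injection E as E1 E2. f_equal.
  - apply Hf; cbn in *; auto.
  - apply IH; cbn in *; auto.
Qed.

(** * Lists over an infinite type inject into it *)

Section ListInjection.
Variable K : Type.
Variable i : nat -> K.
Hypothesis Hi : inj i.

(* [S] is the graph of an injection from the lists over its support into its support. *)
Let supp (S : list K * K -> Prop) (a : K) : Prop := exists k, S ([a], k).
Let graph (S : list K * K -> Prop) : Prop :=
  (forall l k, S (l, k) -> (forall x, In x l -> supp S x) /\ supp S k) /\
  (forall l, (forall x, In x l -> supp S x) -> exists k, S (l, k)) /\
  (forall l k k', S (l, k) -> S (l, k') -> k = k') /\
  (forall l l' k, S (l, k) -> S (l', k) -> l = l').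

Let graph_of_fun (A : K -> Prop) (f : list K -> K) :
  (forall l, (forall x, In x l -> A x) -> A (f l)) ->
  (forall l m, (forall x, In x l -> A x) -> (forall x, In x m -> A x) -> f l = f m -> l = m) ->
  graph (fun p => (forall x, In x (fst p) -> A x) /\ snd p = f (fst p)) /\
  forall a, supp (fun p => (forall x, In x (fst p) -> A x) /\ snd p = f (fst p)) a <-> A a.
Proof.
  intros H1 H2.
  assert (Hs : forall a, supp (fun p => (forall x, In x (fst p) -> A x) /\ snd p = f (fst p)) a <-> A a).
  { intros a; split.
    - intros (k & H & _). apply H; cbn; auto.
    - intros Aa. exists (f [a]). cbn. split; auto. intros x [<-|[]]; auto. }
  split; auto. split; [|split; [|split]]; cbn.
  - intros l k [Hl ->]. split; intros; apply Hs; auto.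
  - intros l Hl. exists (f l). split; auto. intros x Hx; apply Hs; auto.
  - intros l k k' [_ ->] [_ ->]; auto.
  - intros l l' k [Hl ->] [Hl' E]; auto.
Qed.

Let graph_chain (F : (list K * K -> Prop) -> Prop) :
  (forall A, F A -> graph A) ->
  (forall A B, F A -> F B -> (forall t, A t -> B t) \/ (forall t, B t -> A t)) ->
  (exists A, F A) ->
  graph (fun t => exists A, F A /\ A t).
Proof.
  intros FG Fc Fne.
  assert (Hmono : forall A : list K * K -> Prop, F A -> forall a, supp A a ->
     supp (fun t => exists A, F A /\ A t) a).
  { intros A FA a [k Hk]. exists k, A; auto. }
  split; [|split; [|split]].
  - intros l k (A & FA & HA). destruct (proj1 (FG A FA) _ _ HA) as [H1 H2].
    split; eauto.
  - intros l Hl.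
    (* A list has finitely many entries, so one member of the chain supports them all. *)
    assert (exists A, F A /\ forall x, In x l -> supp A x) as (A & FA & HA).
    { induction l as [|x l IH].
      - destruct Fne as [A FA]. exists A. split; auto. intros x [].
      - destruct IH as (A & FA & HA). { intros y Hy; apply Hl; cbn; auto. }
        destruct (Hl x) as (k & B & FB & HB). { cbn; auto. }
        destruct (Fc A B FA FB) as [I|I].
        + exists B. split; auto. intros y [<-|Hy]; [exists k; auto|].
          destruct (HA y Hy) as [k' Hk']. exists k'; auto.
        + exists A. split; auto. intros y [<-|Hy]; [exists k; auto|]. auto. }
    destruct (proj1 (proj2 (FG A FA)) l HA) as [k Hk]. exists k, A; auto.
  - intros l k k' (A & FA & HA) (B & FB & HB).
    destruct (Fc A B FA FB) as [I|I]; apply I in HA || apply I in HB.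
    + exact (proj1 (proj2 (proj2 (FG B FB))) _ _ _ HA HB).
    + exact (proj1 (proj2 (proj2 (FG A FA))) _ _ _ HA HB).
  - intros l l' k (A & FA & HA) (B & FB & HB).
    destruct (Fc A B FA FB) as [I|I]; apply I in HA || apply I in HB.
    + exact (proj2 (proj2 (proj2 (FG B FB))) _ _ _ HA HB).
    + exact (proj2 (proj2 (proj2 (FG A FA))) _ _ _ HA HB).
Qed.

Let graph_fun (S : list K * K -> Prop) : graph S ->
  exists f : list K -> K, forall l, (forall x, In x l -> supp S x) -> S (l, f l).
Proof.
  intros (_ & G & _).
  apply (choice (fun l k => (forall x, In x l -> supp S x) -> S (l, k))).
  intros l. destruct (classic (forall x, In x l -> supp S x)) as [H|H].
  - destruct (G l H) as [k Hk]. exists k; auto.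
  - exists (i 0). tauto.
Qed.

(* A maximal graph [S] has a support [A] whose complement [C] injects into [A]: otherwise [A] embeds
   into [C] with image [B], and as [A + A] embeds into [list A], the lists over the union of [A] and
   [B] embed into [B], which extends [S]. *)
Lemma list_injection : exists f : list K -> K, inj f.
Proof.
  destruct (inj_left_inverse i 0%nat Hi) as [ri Hri].
  destruct (graph_of_fun (fun x => exists n, x = i n) (fun l => i (list_nat_code (map ri l))))
    as [G0 G0s].
  { intros l _. eauto. }
  { intros l m Hl Hm E. apply Hi, list_nat_code_inj in E.
    revert E. apply (map_inj ri (fun x => exists n, x = i n)); auto.
    intros x y [n ->] [k ->]. rewrite !Hri. intros ->; auto. }
  destruct (zorn_sets (fun S => graph S \/ forall t, ~ S t)) as (S & HS & Smax).
  { intros F FP Fc.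
    destruct (classic (exists A, F A /\ graph A)) as [(A & FA & GA)|N].
    - left.
      assert (G : graph (fun t => exists A, (F A /\ graph A) /\ A t)).
      { apply graph_chain; [tauto| |eauto]. intros B C [FB _] [FC _]; auto. }
      replace (fun t => exists A, F A /\ A t) with (fun t => exists A, (F A /\ graph A) /\ A t); auto.
      extensionality t. apply propositional_extensionality. split.
      + intros (B & [FB GB] & Bt); eauto.
      + intros (B & FB & Bt). destruct (FP B FB) as [GB|EB]; [eauto|destruct (EB t Bt)].
    - right. intros t (A & FA & At). destruct (FP A FA) as [GA|EA]; [eauto|exact (EA t At)]. }
  assert (GS : graph S).
  { destruct HS as [GS|ES]; auto. exfalso.
    assert (H : S ([], i (list_nat_code (map ri [])))).
    { apply (Smax _ (or_introl G0)).
      - intros t St; destruct (ES t St).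
      - cbn. split; auto. intros x []. }
    exact (ES _ H). }
  clear HS. destruct (graph_fun S GS) as [f Hf].
  assert (Hfs : forall l, (forall x, In x l -> supp S x) -> supp S (f l)).
  { intros l Hl. exact (proj2 (proj1 GS _ _ (Hf l Hl))). }
  assert (Hfi : forall l m, (forall x, In x l -> supp S x) -> (forall x, In x m -> supp S x) ->
    f l = f m -> l = m).
  { intros l m Hl Hm E. apply (proj2 (proj2 (proj2 GS)) l m (f l)); auto. rewrite E; auto. }
  assert (Hdbl : forall (B : K -> Prop) (h : K -> K), (forall x, B x -> ~ supp S x) ->
    (forall x, B x -> supp S (h x)) -> (forall x y, B x -> B y -> h x = h y -> x = y) ->
    exists e : list K -> K,
      (forall l, (forall x, In x l -> supp S x \/ B x) -> supp S (e l)) /\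
      (forall l m, (forall x, In x l -> supp S x \/ B x) -> (forall x, In x m -> supp S x \/ B x) ->
         e l = e m -> l = m)).
  { intros B h HB h1 h2.
    (* An element of the support becomes a list of length one and an element of [B] a list of length
       two, so the two kinds cannot collide. *)
    destruct (choice (fun x l => (supp S x -> l = [x]) /\ (~ supp S x -> l = [h x; h x]))) as [w Hw].
    { intros x. destruct (classic (supp S x)); [exists [x]|exists [h x; h x]]; tauto. }
    assert (Hws : forall x, supp S x \/ B x -> forall y, In y (w x) -> supp S y).
    { intros x [Hx|Hx] y Hy.
      - rewrite (proj1 (Hw x)) in Hy by auto. destruct Hy as [<-|[]]; auto.
      - rewrite (proj2 (Hw x)) in Hy by auto. destruct Hy as [<-|[<-|[]]]; auto. }
    exists (fun l => f (map (fun x => f (w x)) l)). split.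
    - intros l Hl. apply Hfs. intros y Hy. apply in_map_iff in Hy as (x & <- & Hx). eauto.
    - intros l m Hl Hm E. apply Hfi in E.
      + revert E. apply (map_inj _ (fun x => supp S x \/ B x)); auto.
        intros x y Hx Hy E. apply Hfi in E; eauto.
        destruct (classic (supp S x)) as [Sx|Sx], (classic (supp S y)) as [Sy|Sy].
        * rewrite (proj1 (Hw x) Sx), (proj1 (Hw y) Sy) in E. congruence.
        * rewrite (proj1 (Hw x) Sx), (proj2 (Hw y) Sy) in E. discriminate.
        * rewrite (proj2 (Hw x) Sx), (proj1 (Hw y) Sy) in E. discriminate.
        * rewrite (proj2 (Hw x) Sx), (proj2 (Hw y) Sy) in E. injection E as E. apply h2; tauto.
      + intros y Hy. apply in_map_iff in Hy as (x & <- & Hx). eauto.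
      + intros y Hy. apply in_map_iff in Hy as (x & <- & Hx). eauto. }
  destruct (injection_total (fun x => ~ supp S x) (supp S)) as [(h & h1 & h2)|(h & h1 & h2)].
  - destruct (Hdbl (fun x => ~ supp S x) h) as (e & _ & He); auto.
    exists e. intros l m. apply He; intros; apply classic.
  - exfalso.
    set (B := fun x => exists a, supp S a /\ x = h a).
    assert (Hr : exists r : K -> K, forall a, supp S a -> r (h a) = a).
    { exists (fun x => epsilon (inhabits (i 0%nat)) (fun a => supp S a /\ h a = x)).
      intros a Sa. pose proof (epsilon_spec (inhabits (i 0%nat)) (fun a' => supp S a' /\ h a' = h a))
        as [E1 E2]; eauto. }
    destruct Hr as [r Hr].
    destruct (Hdbl B r) as (e & e1 & e2).
    { intros x (a & Sa & ->); auto. }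
    { intros x (a & Sa & ->). rewrite Hr; auto. }
    { intros x y (a & Sa & ->) (b & Sb & ->). rewrite !Hr by auto. intros ->; auto. }
    (* The old function is kept on lists over the support; all other lists go into [B], which is
       disjoint from the support, so no old value is repeated. *)
    destruct (choice (fun l k => ((forall x, In x l -> supp S x) -> k = f l) /\
                 (~ (forall x, In x l -> supp S x) -> k = h (e l)))) as [f' Hf'].
    { intros l. destruct (classic (forall x, In x l -> supp S x)); [exists (f l)|exists (h (e l))];
        tauto. }
    destruct (graph_of_fun (fun x => supp S x \/ B x) f') as [G' Gs'].
    { intros l Hl. destruct (classic (forall x, In x l -> supp S x)) as [Sl|Sl].
      - rewrite (proj1 (Hf' l)) by auto. auto.
      - rewrite (proj2 (Hf' l)) by auto. right. exists (e l). auto. }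
    { intros l m Hl Hm E.
      destruct (classic (forall x, In x l -> supp S x)) as [Sl|Sl],
               (classic (forall x, In x m -> supp S x)) as [Sm|Sm].
      - rewrite (proj1 (Hf' l) Sl), (proj1 (Hf' m) Sm) in E. auto.
      - rewrite (proj1 (Hf' l) Sl), (proj2 (Hf' m) Sm) in E.
        destruct (h1 (e m)); auto. rewrite <- E; auto.
      - rewrite (proj2 (Hf' l) Sl), (proj1 (Hf' m) Sm) in E.
        destruct (h1 (e l)); auto. rewrite E; auto.
      - rewrite (proj2 (Hf' l) Sl), (proj2 (Hf' m) Sm) in E. apply h2 in E; auto. }
    (* A witness that the extension is proper: [h (f [])] lies in the new support and, by [h1], not
       in the old one. *)
    assert (Sne : supp S (f [])). { apply Hfs. intros x []. }
    apply (h1 _ Sne). exists (f' [h (f [])]).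
    apply (Smax _ (or_introl G')).
    + intros [l k] St. destruct (proj1 GS _ _ St) as [Sl Sk]. cbn. split; auto.
      rewrite (proj1 (Hf' l)) by auto. apply (proj1 (proj2 (proj2 GS)) l); auto.
    + cbn. split; auto. intros x [<-|[]]. right. exists (f []). auto.
Qed.
End ListInjection.

(** * Real numbers and binary sequences *)

Lemma exists_inv_lt (e : R) : 0 < e -> exists n, / (INR n + 1) < e.
Proof.
  intros He. destruct (archimed_cor1 e He) as (n & Hn & Hp). exists n.
  apply Rle_lt_trans with (/ INR n); auto. apply Rinv_le_contravar; [apply lt_0_INR; auto|lra].
Qed.

Lemma half_pow_pos (n : nat) : 0 < (/ 2) ^ n.
Proof. apply pow_lt; lra. Qed.

Lemma half_pow_le (m n : nat) : (m <= n)%nat -> (/ 2) ^ n <= (/ 2) ^ m.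
Proof.
  induction 1 as [|n _ IH]; [lra|]. cbn. pose proof (half_pow_pos n). lra.
Qed.

Lemma half_pow_small (e : R) : 0 < e -> exists n, (/ 2) ^ n < e.
Proof.
  intros He. destruct (pow_lt_1_zero (/ 2)) with (y := e) as [N HN]; auto.
  - rewrite Rabs_pos_eq; lra.
  - exists N. specialize (HN N (le_n N)). rewrite Rabs_pos_eq in HN; auto.
    apply Rlt_le, half_pow_pos.
Qed.

Definition rational (n : nat) : R :=
  let (a, m) := Cantor.of_nat n in let (b, c) := Cantor.of_nat m in INR a / (INR b + 1) - INR c.

Lemma rational_eq (a b c : nat) :
  rational (Cantor.to_nat (a, Cantor.to_nat (b, c))) = INR a / (INR b + 1) - INR c.
Proof. unfold rational. rewrite !Cantor.cancel_of_to. reflexivity. Qed.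

Lemma INR_floor (x : R) : 0 <= x -> exists n, INR n <= x < INR n + 1.
Proof.
  intros Hx. pose proof (archimed x) as [H1 H2].
  assert (0 < up x)%Z by (apply lt_IZR; lra).
  exists (Z.to_nat (up x - 1)). rewrite INR_IZR_INZ, Z2Nat.id by lia.
  rewrite minus_IZR. lra.
Qed.

Lemma rational_between (x y : R) : x < y -> exists n, x < rational n < y.
Proof.
  intros Hxy. destruct (exists_inv_lt (y - x)) as [b Hb]; [lra|].
  assert (Hb0 : 0 < INR b + 1) by (pose proof (pos_INR b); lra).
  destruct (INR_archimed 1 (- x)) as [c Hc]; [lra|].
  destruct (INR_floor ((x + INR c) * (INR b + 1))) as [a Ha].
  { apply Rmult_le_pos; lra. }
  exists (Cantor.to_nat (S a, Cantor.to_nat (b, c))). rewrite rational_eq, S_INR.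
  assert (E : (INR a + 1) / (INR b + 1) = INR a / (INR b + 1) + / (INR b + 1)) by (field; lra).
  assert (x + INR c < (INR a + 1) / (INR b + 1)).
  { apply Rmult_lt_reg_r with (INR b + 1); auto. unfold Rdiv.
    rewrite Rmult_assoc, Rinv_l; lra. }
  assert (INR a / (INR b + 1) <= x + INR c).
  { apply Rmult_le_reg_r with (INR b + 1); auto. unfold Rdiv.
    rewrite Rmult_assoc, Rinv_l; lra. }
  lra.
Qed.

Lemma dedekind_cut_injection : exists f : R -> nat -> bool, inj f.
Proof.
  exists (fun r n => if Rlt_dec (rational n) r then true else false).
  assert (H : forall x y : R, x < y -> (fun n => if Rlt_dec (rational n) x then true else false) <>
     (fun n => if Rlt_dec (rational n) y then true else false)).
  { intros x y Hxy E. destruct (rational_between x y Hxy) as [n Hn].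
    apply (f_equal (fun f => f n)) in E.
    destruct (Rlt_dec (rational n) x), (Rlt_dec (rational n) y); try discriminate; lra. }
  intros x y E. destruct (Rtotal_order x y) as [L|[L|L]]; auto.
  - destruct (H x y L E).
  - destruct (H y x L). auto.
Qed.

Definition agree {B : Type} (n : nat) (a b : nat -> B) : Prop :=
  forall i, (i < n)%nat -> a i = b i.

Lemma first_difference {B : Type} (a b : nat -> B) :
  a <> b -> exists n, agree n a b /\ a n <> b n.
Proof.
  intros H. apply NNPP; intros N. apply H. extensionality n.
  induction n as [n IH] using lt_wf_ind. apply NNPP; intros Hn. apply N. exists n. split; auto.
Qed.

Fixpoint ternary (a : nat -> bool) (n : nat) : R :=
  match n with
  | O => 0
  | S n => ternary a n + (if a n then (/ 3) ^ n else 0)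
  end.

Lemma ternary_agree (a b : nat -> bool) (n : nat) : agree n a b -> ternary a n = ternary b n.
Proof.
  induction n as [|n IH]; intros H; cbn; auto.
  rewrite (H n) by lia. rewrite IH; auto. intros i Hi; apply H; lia.
Qed.

Lemma ternary_bounds (a : nat -> bool) (n k : nat) :
  ternary a n <= ternary a (n + k) <= ternary a n + 3 / 2 * ((/ 3) ^ n - (/ 3) ^ (n + k)).
Proof.
  induction k as [|k IH].
  - rewrite Nat.add_0_r. lra.
  - rewrite Nat.add_succ_r. cbn. assert (0 < (/ 3) ^ (n + k)) by (apply pow_lt; lra).
    destruct (a (n + k)%nat); lra.
Qed.

Lemma ternary_sum (a : nat -> bool) :
  exists s, forall n, ternary a n <= s <= ternary a n + 3 / 2 * (/ 3) ^ n.
Proof.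
  destruct (completeness (fun x => exists n, x = ternary a n)) as [s [H1 H2]].
  - exists (3 / 2). intros x [n ->]. pose proof (ternary_bounds a 0 n). cbn in H.
    assert (0 < (/ 3) ^ n) by (apply pow_lt; lra). lra.
  - exists 0, 0%nat. reflexivity.
  - exists s. intros n. split.
    + apply H1. eauto.
    + apply H2. intros x [m ->]. destruct (Nat.le_ge_cases n m) as [L|L].
      * replace m with (n + (m - n))%nat by lia. pose proof (ternary_bounds a n (m - n)).
        assert (0 < (/ 3) ^ (n + (m - n))) by (apply pow_lt; lra). lra.
      * replace n with (m + (n - m))%nat by lia. pose proof (ternary_bounds a m (n - m)).
        assert (0 < (/ 3) ^ (m + (n - m))) by (apply pow_lt; lra). lra.
Qed.

(** In base 3 the digits after position [n] contribute at most half of the weight [(/ 3) ^ n], so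
    the first difference decides the order. In base 2 the tail could compensate for it. *)
Lemma ternary_injection : exists f : (nat -> bool) -> R, inj f.
Proof.
  destruct (choice _ ternary_sum) as [f Hf]. exists f.
  assert (H : forall a b n, agree n a b -> a n = true -> b n = false -> f b < f a).
  { intros a b n E Ha Hb. pose proof (Hf a (S n)) as A. pose proof (Hf b (S n)) as B.
    cbn in A, B. rewrite Ha in A. rewrite Hb, <- (ternary_agree a b n E) in B.
    assert (0 < (/ 3) ^ n) by (apply pow_lt; lra). lra. }
  intros a b E. apply NNPP; intros N.
  destruct (first_difference a b N) as (n & En & Hn).
  destruct (a n) eqn:An, (b n) eqn:Bn; try congruence.
  - pose proof (H a b n En An Bn). lra.
  - pose proof (H b a n (fun i Hi => eq_sym (En i Hi)) Bn An). lra.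
Qed.

Lemma nat_power_injection {A : Type} (f : A -> nat -> bool) :
  inj f -> exists g : (nat -> A) -> nat -> bool, inj g.
Proof.
  intros Hf. exists (fun a n => let (i, j) := Cantor.of_nat n in f (a i) j).
  intros a b E. extensionality i. apply Hf. extensionality j.
  apply (f_equal (fun h => h (Cantor.to_nat (i, j)))) in E. rewrite Cantor.cancel_of_to in E. auto.
Qed.

(* A code that separates the classes of a partial equivalence relation can be made constant on each
   class by evaluating it at a chosen representative. *)
Lemma class_invariant_code {A B : Type} (P : A -> Prop) (r : A -> A -> Prop) (c : A -> B) :
  (forall x, P x -> r x x) ->
  (forall x y, P x -> P y -> r x y -> r y x) ->
  (forall x y z, P x -> P y -> P z -> r x y -> r y z -> r x z) ->
  (forall x y, P x -> P y -> c x = c y -> r x y) ->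
  exists f : A -> B, forall x y, P x -> P y -> (r x y <-> f x = f y).
Proof.
  intros Hr Hs Ht Hc.
  set (rep := fun x => epsilon (inhabits x) (fun z => P z /\ r x z)).
  assert (Hrep : forall x, P x -> P (rep x) /\ r x (rep x)).
  { intros x Px. apply (epsilon_spec (inhabits x) (fun z => P z /\ r x z)). eauto. }
  exists (fun x => c (rep x)). intros x y Px Py.
  destruct (Hrep x Px) as [P1 R1], (Hrep y Py) as [P2 R2]. split.
  (* Equivalent arguments have the same predicate, but their epsilons start from different
     inhabitants; these do not matter once the predicate is satisfiable. *)
  - intros Rxy. unfold rep. replace (fun z => P z /\ r y z) with (fun z => P z /\ r x z).
    + f_equal. apply epsilon_inh_irrelevance. eauto.
    + extensionality z. apply propositional_extensionality. intuition eauto.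
  - intros E. apply Hc in E; auto. apply Ht with (rep x); auto. apply Ht with (rep y); auto.
Qed.

(** * Homotopy of paths *)

Definition I01 (t : R) : Prop := 0 <= t <= 1.

(** Every reparametrisation below is piecewise linear, so a Lipschitz bound on the unit interval is
    a sufficient and easily checked form of continuity. *)
Definition lipschitz1 (f : R -> R) : Prop :=
  exists L, 0 < L /\ forall u v, I01 u -> I01 v -> Rabs (f u - f v) <= L * Rabs (u - v).

Definition lipschitz2 (f : R -> R -> R) : Prop :=
  exists L, 0 < L /\ forall t u s v, I01 t -> I01 u -> I01 s -> I01 v ->
    Rabs (f t u - f s v) <= L * (Rabs (t - s) + Rabs (u - v)).

Lemma lipschitz2_fst : lipschitz2 (fun t _ => t).
Proof. exists 1. split; [lra|]. intros. pose proof (Rabs_pos (u - v)). lra. Qed.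

Lemma lipschitz2_snd : lipschitz2 (fun _ u => u).
Proof. exists 1. split; [lra|]. intros. pose proof (Rabs_pos (t - s)). lra. Qed.

Lemma lipschitz2_lift (f : R -> R) : lipschitz1 f -> lipschitz2 (fun _ u => f u).
Proof.
  intros (L & HL & H). exists L. split; auto. intros t u s v _ Hu _ Hv.
  specialize (H u v Hu Hv). pose proof (Rabs_pos (t - s)). nra.
Qed.

Lemma lipschitz2_interpolation (f g : R -> R) :
  lipschitz1 f -> lipschitz1 g -> (forall u, I01 u -> I01 (f u)) -> (forall u, I01 u -> I01 (g u)) ->
  lipschitz2 (fun t u => (1 - t) * f u + t * g u).
Proof.
  intros (L & HL & Hf) (M & HM & Hg) If Ig. exists (1 + L + M). split; [lra|].
  intros t u s v [Ht1 Ht2] Hu [Hs1 Hs2] Hv.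
  specialize (Hf u v Hu Hv). specialize (Hg u v Hu Hv).
  destruct (If v Hv), (Ig v Hv).
  replace ((1 - t) * f u + t * g u - ((1 - s) * f v + s * g v)) with
    ((1 - t) * (f u - f v) + t * (g u - g v) + (t - s) * (g v - f v)) by ring.
  pose proof (Rabs_pos (u - v)). pose proof (Rabs_pos (t - s)).
  assert (Rabs ((1 - t) * (f u - f v)) <= L * Rabs (u - v)).
  { rewrite Rabs_mult, (Rabs_pos_eq (1 - t)) by lra. pose proof (Rabs_pos (f u - f v)). nra. }
  assert (Rabs (t * (g u - g v)) <= M * Rabs (u - v)).
  { rewrite Rabs_mult, (Rabs_pos_eq t) by lra. pose proof (Rabs_pos (g u - g v)). nra. }
  assert (Rabs ((t - s) * (g v - f v)) <= Rabs (t - s)).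
  { rewrite Rabs_mult. assert (Rabs (g v - f v) <= 1) by (apply Rabs_le; lra). nra. }
  pose proof (Rabs_triang ((1 - t) * (f u - f v) + t * (g u - g v)) ((t - s) * (g v - f v))).
  pose proof (Rabs_triang ((1 - t) * (f u - f v)) (t * (g u - g v))).
  nra.
Qed.

Section Homotopy.
Context {T : Type} (tau : topology T).

Lemma cont_on_I2_comp (H : R -> R -> T) (f g : R -> R -> R) :
  cont_on_I2 tau H -> lipschitz2 f -> lipschitz2 g ->
  (forall t u, I01 t -> I01 u -> I01 (f t u)) -> (forall t u, I01 t -> I01 u -> I01 (g t u)) ->
  cont_on_I2 tau (fun t u => H (f t u) (g t u)).
Proof.
  intros C (L & HL & Lf) (M & HM & Lg) If Ig t u Ht Hu U OU HU.
  destruct (C _ _ (If t u Ht Hu) (Ig t u Ht Hu) U OU HU) as (del & Hd & HC).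
  exists (del / (2 * (L + M))). split; [apply Rdiv_lt_0_compat; lra|].
  intros s v Hs Hv D1 D2.
  assert (D : (L + M) * (Rabs (s - t) + Rabs (v - u)) < del).
  { replace del with ((L + M) * (del / (2 * (L + M)) + del / (2 * (L + M)))) by (field; lra).
    apply Rmult_lt_compat_l; lra. }
  pose proof (Rabs_pos (s - t)). pose proof (Rabs_pos (v - u)).
  apply HC; [apply If; auto|apply Ig; auto| |].
  - eapply Rle_lt_trans; [apply Lf; auto|]. nra.
  - eapply Rle_lt_trans; [apply Lg; auto|]. nra.
Qed.

Lemma cont_on_I2_swap (H : R -> R -> T) : cont_on_I2 tau H -> cont_on_I2 tau (fun t u => H u t).
Proof.
  intros C. apply (cont_on_I2_comp H (fun _ u => u) (fun t _ => t)); auto using lipschitz2_fst, lipschitz2_snd.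
Qed.

(** Paths are treated as homotopies constant in the first variable, so gluing and reparametrisation
    need be proved only on the square. *)
Lemma cont_on_I_lift (g : R -> T) : cont_on_I tau g <-> cont_on_I2 tau (fun _ u => g u).
Proof.
  split; intros C.
  - intros t u _ Hu U OU HU. destruct (C u Hu U OU HU) as (del & Hd & HC). exists del. auto.
  - intros u Hu U OU HU. assert (H0 : I01 0) by (unfold I01; lra).
    destruct (C 0 u H0 Hu U OU HU) as (del & Hd & HC). exists del. split; auto.
    intros s Hs D. apply (HC 0 s); auto. rewrite Rminus_diag, Rabs_R0. auto.
Qed.

Definition glue {A : Type} (f g : R -> A) (u : R) : A :=
  if Rle_dec u (1 / 2) then f (2 * u) else g (2 * u - 1).

(** Near [u = 1/2] both halves must be controlled, hence the one-sided estimates [L] and [R]. Away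
    from it the chosen radius makes one of them vacuous. *)
Lemma cont_on_I2_glue (H H' : R -> R -> T) :
  cont_on_I2 tau H -> cont_on_I2 tau H' -> (forall t, I01 t -> H t 1 = H' t 0) ->
  cont_on_I2 tau (fun t u => glue (H t) (H' t) u).
Proof.
  intros C C' E t u Ht Hu U OU HU. unfold I01 in *.
  assert (L : exists del, 0 < del /\ forall s v, I01 s -> I01 v -> Rabs (s - t) < del ->
      Rabs (v - u) < del -> v <= 1 / 2 -> U (H s (2 * v))).
  { destruct (Rle_dec u (1 / 2)) as [Lu|Lu].
    - destruct (C t (2 * u) Ht ltac:(lra) U OU) as (del & Hd & HC).
      { unfold glue in HU. destruct (Rle_dec u (1 / 2)); [auto|lra]. }
      exists (del / 2). split; [lra|]. intros s v Hs Hv D1 D2 Lv. unfold I01 in *.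
      apply HC; try lra. apply Rabs_def2 in D2. apply Rabs_def1; lra.
    - exists (u - 1 / 2). split; [lra|]. intros s v Hs Hv D1 D2 Lv.
      apply Rabs_def2 in D2. lra. }
  assert (R : exists del, 0 < del /\ forall s v, I01 s -> I01 v -> Rabs (s - t) < del ->
      Rabs (v - u) < del -> 1 / 2 <= v -> U (H' s (2 * v - 1))).
  { destruct (Rle_dec (1 / 2) u) as [Lu|Lu].
    - destruct (C' t (2 * u - 1) Ht ltac:(lra) U OU) as (del & Hd & HC).
      { unfold glue in HU. destruct (Rle_dec u (1 / 2)); [|auto].
        replace (2 * u - 1) with 0 by lra. rewrite <- E by auto.
        replace 1 with (2 * u) by lra. auto. }
      exists (del / 2). split; [lra|]. intros s v Hs Hv D1 D2 Lv. unfold I01 in *.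
      apply HC; try lra. apply Rabs_def2 in D2. apply Rabs_def1; lra.
    - exists (1 / 2 - u). split; [lra|]. intros s v Hs Hv D1 D2 Lv.
      apply Rabs_def2 in D2. lra. }
  destruct L as (d1 & Hd1 & L), R as (d2 & Hd2 & R).
  pose proof (Rmin_l d1 d2). pose proof (Rmin_r d1 d2).
  exists (Rmin d1 d2). split; [apply Rmin_glb_lt; auto|].
  intros s v Hs Hv D1 D2. unfold glue. destruct (Rle_dec v (1 / 2)).
  - apply L; auto; lra.
  - apply R; auto; lra.
Qed.

(** With the endpoints in the type, composition is total and homotopy becomes an equivalence that
    can be rewritten under [path_comp]. *)
Record path (a b : T) := {
  path_fun :> R -> T;
  path_cont : cont_on_I tau path_fun;
  path_0 : path_fun 0 = a;
  path_1 : path_fun 1 = b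
}.
Arguments path_fun {a b} _ _.
Arguments path_cont {a b} _.
Arguments path_0 {a b} _.
Arguments path_1 {a b} _.

Lemma path_cont2 {a b : T} (p : path a b) : cont_on_I2 tau (fun _ u => p u).
Proof. apply cont_on_I_lift, path_cont. Qed.

Definition path_homotopic {a b : T} (p q : path a b) : Prop :=
  exists H : R -> R -> T, cont_on_I2 tau H /\
    (forall s, I01 s -> H 0 s = p s /\ H 1 s = q s) /\
    (forall t, I01 t -> H t 0 = a /\ H t 1 = b).

Lemma path_homotopic_ext {a b : T} (p q : path a b) :
  (forall s, I01 s -> p s = q s) -> path_homotopic p q.
Proof.
  intros E. exists (fun _ s => p s). split; [|split].
  - apply path_cont2.
  - auto.
  - intros; split; [apply path_0|apply path_1].
Qed.

Lemma path_homotopic_sym {a b : T} (p q : path a b) : path_homotopic p q -> path_homotopic q p.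
Proof.
  intros (H & C & H1 & H2). exists (fun t s => H (1 - t) s). split; [|split].
  - apply (cont_on_I2_comp H (fun t _ => 1 - t) (fun _ s => s)); auto using lipschitz2_snd;
      try (unfold I01; intros; lra).
    exists 1. split; [lra|]. intros. replace (1 - t - (1 - s)) with (- (t - s)) by ring.
    rewrite Rabs_Ropp. pose proof (Rabs_pos (u - v)). lra.
  - intros s Hs. rewrite Rminus_0_r, Rminus_diag. destruct (H1 s Hs); auto.
  - intros t Ht. apply H2. unfold I01 in *; lra.
Qed.

Lemma path_homotopic_trans {a b : T} (p q r : path a b) :
  path_homotopic p q -> path_homotopic q r -> path_homotopic p r.
Proof.
  intros (H & C & H1 & H2) (H' & C' & H1' & H2').
  exists (fun t s => glue (fun t => H t s) (fun t => H' t s) t). split; [|split].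
  (* The gluing is in the homotopy parameter, whereas [cont_on_I2_glue] glues in the second
     variable. *)
  - apply cont_on_I2_swap.
    apply (cont_on_I2_glue (fun s t => H t s) (fun s t => H' t s)); auto using cont_on_I2_swap.
    intros s Hs. transitivity (q s); [apply H1|symmetry; apply H1']; auto.
  - intros s Hs. unfold glue.
    destruct (Rle_dec 0 (1 / 2)); [|lra]. destruct (Rle_dec 1 (1 / 2)); [lra|].
    rewrite Rmult_0_r. replace (2 * 1 - 1) with 1 by ring.
    split; [apply H1|apply H1']; auto.
  - intros t Ht. unfold glue, I01 in *. destruct (Rle_dec t (1 / 2)); [apply H2|apply H2']; lra.
Qed.

#[global] Instance path_homotopic_equiv {a b : T} : Equivalence (@path_homotopic a b).
Proof.
  split; red.
  - intros p. apply path_homotopic_ext. auto.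
  - apply path_homotopic_sym.
  - apply path_homotopic_trans.
Qed.

Definition const_path (a : T) : path a a.
Proof.
  refine {| path_fun := fun _ => a |}; auto.
  intros t _ U _ HU. exists 1. split; [lra|auto].
Defined.

Definition path_comp {a b c : T} (p : path a b) (q : path b c) : path a c.
Proof.
  refine {| path_fun := glue p q |}.
  - apply cont_on_I_lift. apply (cont_on_I2_glue (fun _ => p) (fun _ => q)); try apply path_cont2.
    intros. rewrite path_0. apply path_1.
  - unfold glue. destruct (Rle_dec 0 (1 / 2)); [|lra]. rewrite Rmult_0_r. apply path_0.
  - unfold glue. destruct (Rle_dec 1 (1 / 2)); [lra|].
    replace (2 * 1 - 1) with 1 by ring. apply path_1.
Defined.

(** The map [f] need be neither monotone nor onto, so reversal and restriction to a subinterval are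
    instances. *)
Definition path_reparam {a b : T} (p : path a b) (f : R -> R) (c d : T)
  (Lf : lipschitz1 f) (If : forall u, I01 u -> I01 (f u)) (E0 : p (f 0) = c) (E1 : p (f 1) = d) :
  path c d.
Proof.
  refine {| path_fun := fun u => p (f u) |}; auto.
  apply cont_on_I_lift.
  apply (cont_on_I2_comp (fun _ u => p u) (fun t _ => t) (fun _ u => f u));
    auto using lipschitz2_fst, lipschitz2_lift, path_cont2.
Defined.

(** The interval is convex, so the straight line from [f] to [g] stays in it and keeps the endpoints
    fixed. The groupoid laws follow by writing both sides as reparametrisations of one path. *)
Lemma path_reparam_homotopic {a b c d : T} (p : path a b) (f g : R -> R) (q r : path c d) :
  lipschitz1 f -> lipschitz1 g -> (forall u, I01 u -> I01 (f u)) -> (forall u, I01 u -> I01 (g u)) ->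
  f 0 = g 0 -> f 1 = g 1 ->
  (forall u, I01 u -> q u = p (f u)) -> (forall u, I01 u -> r u = p (g u)) ->
  path_homotopic q r.
Proof.
  intros Lf Lg If Ig E0 E1 Eq Er.
  assert (I0 : I01 0) by (unfold I01; lra). assert (I1 : I01 1) by (unfold I01; lra).
  exists (fun t u => p ((1 - t) * f u + t * g u)). split; [|split].
  - apply (cont_on_I2_comp (fun _ u => p u) (fun t _ => t) (fun t u => (1 - t) * f u + t * g u));
      auto using lipschitz2_fst, lipschitz2_interpolation, path_cont2.
    intros t u [Ht1 Ht2] Hu. destruct (If u Hu), (Ig u Hu). unfold I01. nra.
  - intros s Hs. rewrite Eq, Er by auto. split; f_equal; ring.
  - intros t Ht. rewrite <- E0, <- E1.
    replace ((1 - t) * f 0 + t * f 0) with (f 0) by ring.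
    replace ((1 - t) * f 1 + t * f 1) with (f 1) by ring.
    rewrite <- !Eq by auto. split; [apply path_0|apply path_1].
Qed.

Definition path_rev {a b : T} (p : path a b) : path b a.
Proof.
  refine (path_reparam p (fun u => 1 - u) b a _ _ _ _).
  - exists 1. split; [lra|]. intros. replace (1 - u - (1 - v)) with (- (u - v)) by ring.
    rewrite Rabs_Ropp. lra.
  - unfold I01; intros; lra.
  - rewrite Rminus_0_r. apply path_1.
  - rewrite Rminus_diag. apply path_0.
Defined.

#[global] Instance path_comp_proper {a b c : T} :
  Proper (@path_homotopic a b ==> @path_homotopic b c ==> @path_homotopic a c) path_comp.
Proof.
  intros p p' (H & C & H1 & H2) q q' (H' & C' & H1' & H2').
  exists (fun t => glue (H t) (H' t)). split; [|split].
  - apply cont_on_I2_glue; auto. intros t Ht. destruct (H2 t Ht), (H2' t Ht). congruence.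
  - intros s Hs. cbn. unfold glue, I01 in *. destruct (Rle_dec s (1 / 2)); [apply H1|apply H1']; lra.
  - intros t Ht. unfold glue.
    destruct (Rle_dec 0 (1 / 2)); [|lra]. destruct (Rle_dec 1 (1 / 2)); [lra|].
    rewrite Rmult_0_r. replace (2 * 1 - 1) with 1 by ring.
    split; [apply H2|apply H2']; auto.
Qed.

Local Ltac piecewise :=
  unfold I01 in *; intros; unfold Rmin, Rmax in *;
  repeat match goal with
    | |- context [Rle_dec ?x ?y] => destruct (Rle_dec x y)
    | H : context [Rle_dec ?x ?y] |- _ => destruct (Rle_dec x y)
    end; try lra.

Local Ltac lipschitz L :=
  exists L; split; [lra|]; intros u v _ _;
  pose proof (Rle_abs (u - v)); pose proof (Rle_abs (v - u)) as Hvu;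
  rewrite (Rabs_minus_sym v u) in Hvu;
  apply Rabs_le; piecewise.

Lemma path_comp_assoc {a b c d : T} (p : path a b) (q : path b c) (r : path c d) :
  path_homotopic (path_comp (path_comp p q) r) (path_comp p (path_comp q r)).
Proof.
  (* The piecewise linear map taking the break points 1/2 and 3/4 to 1/4 and 1/2 is convex, hence
     the maximum of its three linear pieces. *)
  apply (path_reparam_homotopic (path_comp (path_comp p q) r) (fun u => u)
    (fun u => Rmax (Rmax (u / 2) (u - 1 / 4)) (2 * u - 1))).
  - lipschitz 1.
  - lipschitz 2.
  - auto.
  - piecewise.
  - piecewise.
  - piecewise.
  - auto.
  - intros u Hu. cbn. unfold glue, I01 in *.
    piecewise; f_equal; lra.
Qed.

Lemma path_comp_const_l {a b : T} (p : path a b) :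
  path_homotopic (path_comp (const_path a) p) p.
Proof.
  apply (path_reparam_homotopic p (fun u => Rmax 0 (2 * u - 1)) (fun u => u)).
  - lipschitz 2.
  - lipschitz 1.
  - piecewise.
  - auto.
  - piecewise.
  - piecewise.
  - intros u Hu. cbn. unfold glue. piecewise.
    + replace (2 * u - 1) with 0 by lra. symmetry; apply path_0.
    + symmetry; apply path_0.
    + auto.
  - auto.
Qed.

Lemma path_comp_const_r {a b : T} (p : path a b) :
  path_homotopic (path_comp p (const_path b)) p.
Proof.
  apply (path_reparam_homotopic p (fun u => Rmin 1 (2 * u)) (fun u => u)).
  - lipschitz 2.
  - lipschitz 1.
  - piecewise.
  - auto.
  - piecewise.
  - piecewise.
  - intros u Hu. cbn. unfold glue. piecewise.
    + f_equal; lra.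
    + auto.
    + symmetry; apply path_1.
  - auto.
Qed.

(** The out-and-back parameter starts and ends at 0, so it deforms linearly to the constant 0. *)
Lemma path_comp_rev_r {a b : T} (p : path a b) :
  path_homotopic (path_comp p (path_rev p)) (const_path a).
Proof.
  apply (path_reparam_homotopic p (fun u => Rmin (2 * u) (2 - 2 * u)) (fun u => 0)).
  - lipschitz 2.
  - lipschitz 1.
  - piecewise.
  - piecewise.
  - piecewise.
  - piecewise.
  - intros u Hu. cbn. unfold glue. piecewise; f_equal; lra.
  - intros u Hu. cbn. symmetry; apply path_0.
Qed.

Lemma path_comp_rev_l {a b : T} (p : path a b) :
  path_homotopic (path_comp (path_rev p) p) (const_path b).
Proof.
  apply (path_reparam_homotopic p (fun u => Rmax (1 - 2 * u) (2 * u - 1)) (fun u => 1)).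
  - lipschitz 2.
  - lipschitz 1.
  - piecewise.
  - piecewise.
  - piecewise.
  - piecewise.
  - intros u Hu. cbn. unfold glue. piecewise; f_equal; lra.
  - intros u Hu. cbn. symmetry; apply path_1.
Qed.

Lemma path_comp_cancel_l {a b c : T} (p : path a b) (q r : path b c) :
  path_homotopic (path_comp p q) (path_comp p r) -> path_homotopic q r.
Proof.
  intros H. rewrite <- (path_comp_const_l q), <- (path_comp_const_l r), <- (path_comp_rev_l p).
  rewrite !path_comp_assoc, H. reflexivity.
Qed.

Lemma path_comp_cancel_r {a b c : T} (p q : path a b) (r : path b c) :
  path_homotopic (path_comp p r) (path_comp q r) -> path_homotopic p q.
Proof.
  intros H. rewrite <- (path_comp_const_r p), <- (path_comp_const_r q), <- (path_comp_rev_r r).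
  rewrite <- !path_comp_assoc, H. reflexivity.
Qed.

Lemma path_comp_maps {a b c : T} (p : path a b) (q : path b c) (U : T -> Prop) :
  (forall u, I01 u -> U (p u)) -> (forall u, I01 u -> U (q u)) ->
  forall u, I01 u -> U (path_comp p q u).
Proof.
  intros Hp Hq u Hu. cbn. unfold glue, I01 in *. destruct (Rle_dec u (1 / 2)); [apply Hp|apply Hq]; lra.
Qed.

Lemma path_rev_maps {a b : T} (p : path a b) (U : T -> Prop) :
  (forall u, I01 u -> U (p u)) -> forall u, I01 u -> U (path_rev p u).
Proof. intros Hp u Hu. cbn. apply Hp. unfold I01 in *; lra. Qed.

(** The endpoints are free names tied by equations, so that subpaths compose without transport when
    an endpoint is only provably [x0]. *)
Definition subpath {a b : T} (p : path a b) (s t : R) (c d : T) (Is : I01 s) (It : I01 t)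
  (Ec : p s = c) (Ed : p t = d) : path c d.
Proof.
  refine (path_reparam p (fun u => s + (t - s) * u) c d _ _ _ _).
  - exists (1 + Rabs (t - s)). pose proof (Rabs_pos (t - s)). split; [lra|].
    intros u v _ _. replace (s + (t - s) * u - (s + (t - s) * v)) with ((t - s) * (u - v)) by ring.
    rewrite Rabs_mult. apply Rmult_le_compat_r; [apply Rabs_pos|lra].
  - unfold I01 in *. intros u Hu. nra.
  - rewrite Rmult_0_r, Rplus_0_r. auto.
  - rewrite Rmult_1_r. replace (s + (t - s)) with t by ring. auto.
Defined.

Lemma subpath_comp {a b : T} (p : path a b) (r s t : R) (c d e : T)
  (Ir : I01 r) (Is : I01 s) (It : I01 t) (Ec : p r = c) (Ed : p s = d) (Ee : p t = e) :
  path_homotopic (path_comp (subpath p r s c d Ir Is Ec Ed) (subpath p s t d e Is It Ed Ee))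
    (subpath p r t c e Ir It Ec Ee).
Proof.
  apply (path_reparam_homotopic p
    (fun u => r + (s - r) * Rmin 1 (2 * u) + (t - s) * Rmax 0 (2 * u - 1))
    (fun u => r + (t - r) * u)).
  - exists (1 + 2 * Rabs (s - r) + 2 * Rabs (t - s)).
    pose proof (Rabs_pos (s - r)). pose proof (Rabs_pos (t - s)). split; [lra|].
    intros u v _ _.
    replace (r + (s - r) * Rmin 1 (2 * u) + (t - s) * Rmax 0 (2 * u - 1) -
       (r + (s - r) * Rmin 1 (2 * v) + (t - s) * Rmax 0 (2 * v - 1))) with
      ((s - r) * (Rmin 1 (2 * u) - Rmin 1 (2 * v)) +
       (t - s) * (Rmax 0 (2 * u - 1) - Rmax 0 (2 * v - 1))) by ring.
    assert (Rabs (Rmin 1 (2 * u) - Rmin 1 (2 * v)) <= 2 * Rabs (u - v)).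
    { pose proof (Rle_abs (u - v)). pose proof (Rle_abs (v - u)) as Hvu.
      rewrite (Rabs_minus_sym v u) in Hvu. apply Rabs_le; piecewise. }
    assert (Rabs (Rmax 0 (2 * u - 1) - Rmax 0 (2 * v - 1)) <= 2 * Rabs (u - v)).
    { pose proof (Rle_abs (u - v)). pose proof (Rle_abs (v - u)) as Hvu.
      rewrite (Rabs_minus_sym v u) in Hvu. apply Rabs_le; piecewise. }
    eapply Rle_trans; [apply Rabs_triang|]. rewrite !Rabs_mult.
    pose proof (Rabs_pos (u - v)). nra.
  - exists (1 + Rabs (t - r)). pose proof (Rabs_pos (t - r)). split; [lra|].
    intros u v _ _. replace (r + (t - r) * u - (r + (t - r) * v)) with ((t - r) * (u - v)) by ring.
    rewrite Rabs_mult. apply Rmult_le_compat_r; [apply Rabs_pos|lra].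
  - intros u Hu. unfold Rmin, Rmax. unfold I01 in *.
    destruct (Rle_dec 1 (2 * u)), (Rle_dec 0 (2 * u - 1)); nra.
  - unfold I01 in *. intros u Hu. nra.
  - cbn beta. rewrite Rmin_right, Rmax_left by lra. ring.
  - cbn beta. rewrite Rmin_left, Rmax_right by lra. ring.
  - intros u Hu. cbn. unfold glue, I01, Rmin, Rmax in *.
    destruct (Rle_dec u (1 / 2)), (Rle_dec 1 (2 * u)), (Rle_dec 0 (2 * u - 1)); try lra; f_equal; nra.
  - reflexivity.
Qed.

Definition loop_path (a : T) (g : R -> T) (Hg : is_loop tau a g) : path a a :=
  {| path_fun := g; path_cont := proj1 Hg; path_0 := proj1 (proj2 Hg); path_1 := proj2 (proj2 Hg) |}.

Lemma path_is_loop {a : T} (p : path a a) : is_loop tau a p.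
Proof. split; [apply path_cont|split; [apply path_0|apply path_1]]. Qed.

End Homotopy.
Arguments path_fun {T tau a b} _ _.

(** * Relatively simple spaces *)

(** The dense set becomes a family indexed by all of [K]; [x0] only serves to inhabit the choice for
    indices that name no point. *)
Lemma separable_decode {K X : Type} (tau : topology X) (x0 : X) :
  k_separable K tau ->
  exists dec : K -> X, forall x U, is_open tau U -> U x -> exists k, U (dec k).
Proof.
  intros (D & HD & f & Hf).
  exists (fun k => epsilon (inhabits x0) (fun x => D x /\ f x = k)).
  intros x U OU Ux. destruct (HD x U OU Ux) as (y & Uy & Dy). exists (f y).
  destruct (epsilon_spec (inhabits x0) (fun x => D x /\ f x = f y)) as [E1 E2]; eauto.
  rewrite (Hf _ y E1 Dy E2). auto.
Qed.

Lemma metric_ball_open {X : Type} (tau : topology X) (d : X -> X -> R) (x : X) (e : R) :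
  is_metric d -> (forall U, is_open tau U <-> metric_open d U) -> is_open tau (fun y => d x y < e).
Proof.
  intros (_ & _ & _ & Htri) Htau. apply Htau. intros y Hy. exists (e - d x y). split; [lra|].
  intros z Hz. pose proof (Htri x y z). lra.
Qed.

Lemma interpolation_between (a b t : R) : a <= b -> I01 t -> a <= a + (b - a) * t <= b.
Proof. unfold I01. intros. nra. Qed.

Lemma lebesgue_number_I {T : Type} (tau : topology T) (J : Type) (W : J -> T -> Prop) (g : R -> T) :
  (forall j, is_open tau (W j)) -> (forall x, exists j, W j x) -> cont_on_I tau g ->
  exists e, 0 < e /\ forall t, I01 t -> exists j, forall s, I01 s -> Rabs (s - t) < e -> W j (g s).
Proof.
  intros OW HW C.
  (* Twice the radius is secured because [s] is near [t] and [t] near the centre [u], each within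
     [del u]. *)
  assert (H : forall t, exists del : posreal, I01 t ->
    exists j, forall s, I01 s -> Rabs (s - t) < 2 * del -> W j (g s)).
  { intros t. destruct (classic (I01 t)) as [Ht|Ht].
    - destruct (HW (g t)) as [j Hj]. destruct (C t Ht (W j) (OW j) Hj) as (del & Hd & HC).
      assert (Hd2 : 0 < del / 2) by lra.
      exists (mkposreal _ Hd2). intros _. exists j. intros s Hs D. apply HC; auto. cbn in D. lra.
    - exists (mkposreal 1 Rlt_0_1). tauto. }
  destruct (choice _ H) as [del Hdel].
  destruct (Compactness.compactness_value_1d 0 1 del) as [e He].
  exists e. split; [apply cond_pos|]. intros t Ht.
  destruct (NNPP _ (He t Ht)) as (u & Hu & D & L).
  destruct (Hdel u Hu) as [j Hj]. exists j. intros s Hs Ds. apply Hj; auto.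
  replace (s - u) with ((s - t) + (t - u)) by ring.
  eapply Rle_lt_trans; [apply Rabs_triang|]. lra.
Qed.

Lemma lebesgue_partition {T : Type} (tau : topology T) (J : Type) (W : J -> T -> Prop) (g : R -> T) :
  (forall j, is_open tau (W j)) -> (forall x, exists j, W j x) -> cont_on_I tau g ->
  exists N, (0 < N)%nat /\ forall k, (k < N)%nat -> exists j,
    forall s, INR k / INR N <= s <= INR (S k) / INR N -> W j (g s).
Proof.
  intros OW HW C. destruct (lebesgue_number_I tau J W g OW HW C) as (e & He & H).
  destruct (exists_inv_lt e He) as [n Hn]. exists (S n). split; [lia|]. intros k Hk.
  assert (Hp : 0 < INR (S n)) by (apply lt_0_INR; lia).
  assert (Hi : 0 < / INR (S n)) by (apply Rinv_0_lt_compat; auto).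
  assert (H0 : 0 <= INR k / INR (S n)).
  { apply Rmult_le_pos; [apply pos_INR|lra]. }
  assert (H1 : INR (S k) / INR (S n) <= 1).
  { apply Rmult_le_reg_r with (INR (S n)); auto. unfold Rdiv. rewrite Rmult_assoc, Rinv_l by lra.
    rewrite Rmult_1_r, Rmult_1_l. apply le_INR; lia. }
  assert (E : INR (S k) / INR (S n) = INR k / INR (S n) + / INR (S n)).
  { rewrite (S_INR k). field. lra. }
  destruct (H (INR k / INR (S n))) as [j Hj]. { unfold I01; lra. }
  exists j. intros s Hs. apply Hj.
  - unfold I01; lra.
  - rewrite Rabs_pos_eq by lra. rewrite <- S_INR in Hn. lra.
Qed.

(** * Counting homotopy classes by finite chains *)

Section Counting.
Context {K X : Type} (tau : topology X) (d : X -> X -> R).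
Hypothesis Hd : is_metric d.
Hypothesis Htau : forall U, is_open tau U <-> metric_open d U.
Hypothesis Xlpc : locally_path_connected tau.

(** Only the paths are confined to [V]; the homotopy may leave it. *)
Definition relatively_simple (V : X -> Prop) : Prop :=
  is_open tau V /\ forall a b (p q : path tau a b),
    (forall t, I01 t -> V (p t)) -> (forall t, I01 t -> V (q t)) -> path_homotopic tau p q.

(** The assumption concerns loops at [x] only. Two paths in [V] are therefore compared through the
    loop that goes along [r] from [x], along [p], back along [q] and back along [r]; it lies in [U],
    and cancellation does the rest. *)
Let relatively_simple_nbhd (x : X) :
  (exists U, is_open tau U /\ U x /\
    forall p : path tau x x, (forall t, I01 t -> U (p t)) -> path_homotopic tau p (const_path tau x)) ->
  exists V, relatively_simple V /\ V x.
Proof.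
  intros (U & OU & Ux & HU). destruct (Xlpc x U OU Ux) as (V & OV & Vx & VU & HV).
  exists V. split; auto. split; auto. intros a b p q Hp Hq.
  assert (Va : V a). { rewrite <- (path_0 _ _ _ p). apply Hp. unfold I01; lra. }
  destruct (HV x a Vx Va) as (r0 & (Cr & R0 & R1) & Hr).
  set (r := {| path_fun := r0; path_cont := Cr; path_0 := R0; path_1 := R1 |} : path tau x a).
  assert (E : path_homotopic tau (path_comp tau (path_comp tau (path_comp tau r p) (path_rev tau q))
     (path_rev tau r)) (const_path tau x)).
  { apply HU. intros t Ht. apply VU. revert t Ht.
    apply path_comp_maps; [apply path_comp_maps; [apply path_comp_maps|apply path_rev_maps]|
      apply path_rev_maps]; auto. }
  apply (path_comp_cancel_l tau r), (path_comp_cancel_r tau _ _ (path_rev tau q)),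
    (path_comp_cancel_r tau _ _ (path_rev tau r)).
  rewrite E. rewrite (path_comp_assoc tau r q), (path_comp_rev_r tau q), (path_comp_const_r tau r).
  symmetry. apply path_comp_rev_r.
Qed.

Variable i : nat -> K.
Hypothesis Hi : inj i.
Variable dec : K -> X.
Hypothesis Hdec : forall x U, is_open tau U -> U x -> exists k, U (dec k).
Variable e : list K -> K.
Hypothesis He : inj e.
Hypothesis Hsimple : forall x, exists U, is_open tau U /\ U x /\
  forall p : path tau x x, (forall t, I01 t -> U (p t)) -> path_homotopic tau p (const_path tau x).

Let relatively_simple_cover :
  exists W : K -> X -> Prop, (forall k, relatively_simple (W k)) /\ forall x, exists k, W k x.
Proof.
  (* The index [e [c; i n]] stands for the ball of radius [(/ 2) ^ n] about [dec c]; it selects a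
     relatively simple set containing that ball if there is one, and an arbitrary one otherwise. *)
  assert (H : forall k, exists V, relatively_simple V /\
    forall c n, k = e [c; i n] -> (exists V', relatively_simple V' /\ forall y, d (dec c) y < (/ 2) ^ n -> V' y) ->
      forall y, d (dec c) y < (/ 2) ^ n -> V y).
  { intros k. destruct (classic (exists c n, k = e [c; i n] /\
      exists V', relatively_simple V' /\ forall y, d (dec c) y < (/ 2) ^ n -> V' y))
      as [(c & n & -> & V & HV & HB)|N].
    - exists V. split; auto. intros c' n' E _. apply He in E. injection E as <- E.
      apply Hi in E as <-. auto.
    - destruct (relatively_simple_nbhd (dec k) (Hsimple (dec k))) as (V & HV & _).
      exists V. split; auto. intros c n E E'. destruct N; eauto. }
  destruct (choice _ H) as [W HW]. exists W. split; [intros; apply HW|].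
  intros x. destruct (relatively_simple_nbhd x (Hsimple x)) as (V & HV & Vx).
  destruct (proj1 (Htau V) (proj1 HV) x Vx) as (r & Hr & HrV).
  destruct (half_pow_small (r / 2)) as [n Hn]; [lra|].
  destruct (Hdec x (fun y => d x y < (/ 2) ^ n)) as [c Hc].
  { apply metric_ball_open; auto. }
  { rewrite (proj2 (proj1 (proj2 Hd) x x) eq_refl). apply half_pow_pos. }
  destruct Hd as (_ & _ & Hsym & Htri).
  exists (e [c; i n]). apply (proj2 (HW (e [c; i n])) c n); auto.
  - exists V. split; auto. intros y Hy. apply HrV. pose proof (Htri x (dec c) y). lra.
  - rewrite Hsym. auto.
Qed.

Section Code.
Variable W : K -> X -> Prop.
Hypothesis HW : forall k, relatively_simple (W k).
Hypothesis Wcover : forall x, exists k, W k x.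
Variable x0 : X.

(* The pieces of the loop lie in the sets [W (w k)], and [dec (v k)] marks the path component
   of the [k]-th division point in the intersection of two successive sets. *)
Let coded (p : path tau x0 x0) (l : list K) : Prop :=
  exists N w v, (0 < N)%nat /\ l = map (fun k => e [w k; v k]) (seq 0 N) /\
    (forall k, (k < N)%nat -> forall s, INR k / INR N <= s <= INR (S k) / INR N -> W (w k) (p s)) /\
    (forall k, (S k < N)%nat -> exists r : path tau (p (INR (S k) / INR N)) (dec (v (S k))),
       forall t, I01 t -> W (w k) (r t) /\ W (w (S k)) (r t)).

Let exists_code (p : path tau x0 x0) : exists l, coded p l.
Proof.
  destruct (lebesgue_partition tau K W p) as (N & HN & H); auto.
  { intros k; apply HW. }
  { apply path_cont. }
  destruct (choice (fun k j => (k < N)%nat ->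
    forall s, INR k / INR N <= s <= INR (S k) / INR N -> W j (p s))) as [w Hw].
  { intros k. destruct (Nat.lt_ge_cases k N) as [L|L].
    - destruct (H k L) as [j Hj]; eauto.
    - exists (i 0). lia. }
  assert (HNp : 0 < INR N) by (apply lt_0_INR; auto).
  assert (Hle : forall k, INR k / INR N <= INR (S k) / INR N).
  { intros k. apply Rmult_le_compat_r; [apply Rlt_le, Rinv_0_lt_compat; auto|apply le_INR; lia]. }
  destruct (choice (fun k c => forall k', k = S k' -> (k < N)%nat ->
    exists r : path tau (p (INR k / INR N)) (dec c), forall t, I01 t -> W (w k') (r t) /\ W (w k) (r t)))
    as [v Hv].
  (* Index 0 has no preceding set, so its marker is a dummy. *)
  { intros [|k]. { exists (i 0). discriminate. }
    destruct (Nat.lt_ge_cases (S k) N) as [L|L]; [|exists (i 0); lia].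
    set (x := p (INR (S k) / INR N)).
    (* A path connected neighbourhood inside the intersection contains a point [dec c], which is
       thus joined to the division point within both sets. *)
    destruct (Xlpc x (fun y => W (w k) y /\ W (w (S k)) y)) as (V & OV & Vx & VW & HV).
    { apply open_inter; apply HW. }
    { split; [apply (Hw k)|apply (Hw (S k))]; auto; try lia; split; auto; lra. }
    destruct (Hdec x V OV Vx) as [c Hc].
    destruct (HV x (dec c) Vx Hc) as (r & (Cr & R0 & R1) & Hr).
    exists c. intros k' [= <-] _.
    exists {| path_fun := r; path_cont := Cr; path_0 := R0; path_1 := R1 |}.
    cbn. auto. }
  exists (map (fun k => e [w k; v k]) (seq 0 N)), N, w, v. repeat split; auto.
Qed.

(** At each division point both loops are joined to the same marker, so they are joined to each
    other by a path [rk] inside the two successive sets. This cuts the region between the loops into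
    squares, each lying in one set [W (w k)]. *)
Let coded_homotopic (p q : path tau x0 x0) (l : list K) :
  coded p l -> coded q l -> path_homotopic tau p q.
Proof.
  intros (N & w & v & HN & -> & P1 & P2) (N' & w' & v' & HN' & E & Q1 & Q2).
  assert (N' = N) as ->.
  { apply (f_equal (@length K)) in E. rewrite !length_map, !length_seq in E. auto. }
  assert (Ewv : forall k, (k < N)%nat -> w' k = w k /\ v' k = v k).
  { intros k Hk. pose proof (f_equal (fun l => nth k l (e [])) E) as En. cbv beta in En.
    rewrite !(nth_indep _ (e []) (e [w 0%nat; v 0%nat])) in En by (rewrite length_map, length_seq; auto).
    rewrite (map_nth (fun k => e [w k; v k])) in En.
    rewrite (nth_indep _ _ (e [w' 0%nat; v' 0%nat])) in En by (rewrite length_map, length_seq; auto).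
    rewrite (map_nth (fun k => e [w' k; v' k])), seq_nth in En by auto.
    apply He in En. injection En as -> ->. auto. }
  assert (HNp : 0 < INR N) by (apply lt_0_INR; auto).
  assert (Hinv : 0 < / INR N) by (apply Rinv_0_lt_compat; auto).
  assert (It : forall k, (k <= N)%nat -> I01 (INR k / INR N)).
  { intros k Hk. apply le_INR in Hk. pose proof (pos_INR k). split.
    - apply Rmult_le_pos; lra.
    - apply Rmult_le_reg_r with (INR N); auto. unfold Rdiv. rewrite Rmult_assoc, Rinv_l by lra. lra. }
  assert (Hle : forall k, INR k / INR N <= INR (S k) / INR N).
  { intros k. apply Rmult_le_compat_r; [lra|apply le_INR; lia]. }
  assert (T0 : INR 0 / INR N = 0) by (cbn; unfold Rdiv; ring).
  assert (T1 : INR N / INR N = 1) by (field; lra).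
  assert (I0 : I01 0) by (unfold I01; lra).
  assert (Hbetween : forall (g : path tau x0 x0) k x y Ik Ik' Ex Ey,
     (forall s, INR k / INR N <= s <= INR (S k) / INR N -> W (w k) (g s)) ->
     forall t, I01 t -> W (w k) (subpath tau g (INR k / INR N) (INR (S k) / INR N) x y Ik Ik' Ex Ey t)).
  { intros g k x y Ik Ik' Ex Ey Hg t Ht. apply Hg, interpolation_between; auto. }
  (* The connecting path [r] is arbitrary: the induction uses it with [rk], the last division point
     with a constant path. *)
  assert (step : forall k, (k < N)%nat ->
    forall (x y : X) (r : path tau x y), (forall t, I01 t -> W (w k) (r t)) ->
    forall Ip Ep Eq' Ep' Eq'',
    path_homotopic tau
      (path_comp tau (subpath tau p 0 (INR (S k) / INR N) x0 x I0 Ip Ep Ep') r)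
      (subpath tau q 0 (INR (S k) / INR N) x0 y I0 Ip Eq' Eq'')).
  { induction k as [|k IH]; intros Hk x y r Hr Ip Ep Eq' Ep' Eq''.
    - apply (proj2 (HW (w 0%nat))).
      + apply path_comp_maps; auto. intros t Ht. apply (P1 0%nat); auto.
        rewrite T0. apply interpolation_between; auto. apply Ip.
      + intros t Ht. rewrite <- (proj1 (Ewv 0%nat Hk)). apply (Q1 0%nat); auto.
        rewrite T0. apply interpolation_between; auto. apply Ip.
    - destruct (P2 k Hk) as [rp Hrp]. pose proof (Q2 k Hk) as Hq.
      destruct (Ewv k) as [Ew0 _]; [lia|]. destruct (Ewv (S k) Hk) as [Ew1 Ev].
      rewrite Ew0, Ew1, Ev in Hq. destruct Hq as [rq Hrq].
      set (rk := path_comp tau rp (path_rev tau rq)).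
      assert (Hrk : forall t, I01 t -> W (w k) (rk t) /\ W (w (S k)) (rk t)).
      { intros t Ht. split; revert t Ht; apply path_comp_maps; try apply path_rev_maps;
          intros; try apply Hrp; try apply Hrq; auto. }
      assert (Ik : I01 (INR (S k) / INR N)) by (apply It; lia).
      specialize (IH ltac:(lia) _ _ rk (fun t Ht => proj1 (Hrk t Ht)) Ik Ep Eq' eq_refl eq_refl).
      rewrite <- (subpath_comp tau p 0 _ _ _ _ _ I0 Ik Ip Ep eq_refl Ep').
      rewrite <- (subpath_comp tau q 0 _ _ _ _ _ I0 Ik Ip Eq' eq_refl Eq'').
      rewrite <- IH. rewrite !path_comp_assoc.
      apply path_comp_proper; [reflexivity|].
      (* What is left is one square: the piece of [p] followed by [r] against [rk] followed by the
         piece of [q], all inside [W (w (S k))]. *)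
      apply (proj2 (HW (w (S k)))).
      + apply path_comp_maps; auto.
      + apply path_comp_maps; [apply Hrk|]. apply Hbetween; auto. rewrite <- Ew1. auto. }
  destruct N as [|n]; [lia|].
  assert (Ep : p (INR (S n) / INR (S n)) = x0) by (rewrite T1; apply path_1).
  assert (Eq : q (INR (S n) / INR (S n)) = x0) by (rewrite T1; apply path_1).
  assert (Ip : I01 (INR (S n) / INR (S n))) by (apply It; auto).
  specialize (step n ltac:(lia) x0 x0).
  assert (Hx : forall t, I01 t -> W (w n) (const_path tau x0 t)).
  { intros t _. cbn. rewrite <- Ep. apply (P1 n); auto. split; auto; lra. }
  specialize (step (const_path tau x0) Hx Ip (path_0 _ _ _ p) (path_0 _ _ _ q) Ep Eq).
  rewrite path_comp_const_r in step.
  assert (Hfull : forall (g : path tau x0 x0) E1 E2,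
    path_homotopic tau (subpath tau g 0 (INR (S n) / INR (S n)) x0 x0 I0 Ip E1 E2) g).
  { intros g E1 E2. apply path_homotopic_ext. intros s _. cbn -[INR]. rewrite T1. f_equal. ring. }
  rewrite !Hfull in step. auto.
Qed.

Lemma pi1_card_le_of_cover : pi1_card_le K tau x0.
Proof.
  destruct (choice (fun g l => forall Hg, coded (loop_path tau x0 g Hg) l)) as [c Hc].
  { intros g. destruct (classic (is_loop tau x0 g)) as [Hg|Hg].
    - destruct (exists_code (loop_path tau x0 g Hg)) as [l Hl]. exists l. intros Hg'.
      rewrite (proof_irrelevance _ Hg' Hg). auto.
    - exists []. tauto. }
  apply (class_invariant_code (is_loop tau x0) (loop_homotopic tau x0) (fun g => e (c g))).
  - intros g Hg. apply (path_homotopic_ext tau (loop_path tau x0 g Hg) (loop_path tau x0 g Hg)). auto.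
  - intros g h Hg Hh. apply (path_homotopic_sym tau (loop_path tau x0 g Hg) (loop_path tau x0 h Hh)).
  - intros g h k Hg Hh Hk. apply (path_homotopic_trans tau (loop_path tau x0 g Hg)
      (loop_path tau x0 h Hh) (loop_path tau x0 k Hk)).
  - intros g h Hg Hh E. apply He in E.
    apply (coded_homotopic (loop_path tau x0 g Hg) (loop_path tau x0 h Hh) (c g)); auto.
    rewrite E. auto.
Qed.
End Code.

Lemma pi1_card_le_of_simple (x0 : X) : pi1_card_le K tau x0.
Proof. destruct relatively_simple_cover as (W & HW & Wc). eapply pi1_card_le_of_cover; eauto. Qed.
End Counting.

(** * Infinite concatenations *)

Section InfiniteConcatenation.
Context {T : Type} (tau : topology T) (x : T).
Implicit Types D : nat -> path tau x x.

Definition shift {A : Type} (a : nat -> A) (n : nat) : A := a (S n).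

(** Nesting to the right puts loop [k] on the interval from [1 - (/ 2) ^ k] to [1 - (/ 2) ^ (S k)]
    whatever [n > k] is, so the partial concatenations stabilise. *)
Fixpoint partial_concat (n : nat) D : path tau x x :=
  match n with
  | O => const_path tau x
  | S n => path_comp tau (D O) (partial_concat n (shift D))
  end.

Lemma partial_concat_stable (n m : nat) D (s : R) :
  (n <= m)%nat -> 0 <= s <= 1 - (/ 2) ^ n -> partial_concat m D s = partial_concat n D s.
Proof.
  revert m D s. induction n as [|n IH]; intros m D s Hnm Hs.
  - replace s with 0 by (cbn in Hs; lra). rewrite !path_0. reflexivity.
  - destruct m as [|m]; [lia|]. cbn. unfold glue. destruct (Rle_dec s (1 / 2)); auto.
    apply IH; [lia|]. cbn in Hs. lra.
Qed.

Lemma partial_concat_agree (n : nat) D D' (s : R) :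
  agree n D D' -> partial_concat n D s = partial_concat n D' s.
Proof.
  revert D D' s. induction n as [|n IH]; intros D D' s H; auto.
  cbn. unfold glue. destruct (Rle_dec s (1 / 2)).
  - rewrite (H O); auto. lia.
  - apply IH. intros k Hk. apply H. lia.
Qed.

Lemma partial_concat_maps (n : nat) D (U : T -> Prop) :
  U x -> (forall k s, I01 s -> U (D k s)) -> forall s, I01 s -> U (partial_concat n D s).
Proof.
  intros Ux. revert D. induction n as [|n IH]; intros D HD; [auto|].
  apply path_comp_maps; auto. apply IH. intros k. apply HD.
Qed.

(* On [0, 1 - 2^-n] the infinite concatenation is given by its first [n] loops. *)
Definition infinite_concat_fun D (s : R) : T :=
  if Rlt_dec s 1 then partial_concat (epsilon (inhabits O) (fun n => s <= 1 - (/ 2) ^ n)) D s else x.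

Lemma infinite_concat_partial (n : nat) D (s : R) :
  0 <= s <= 1 - (/ 2) ^ n -> infinite_concat_fun D s = partial_concat n D s.
Proof.
  intros Hs. pose proof (half_pow_pos n). unfold infinite_concat_fun.
  destruct (Rlt_dec s 1); [|lra].
  assert (Hm : s <= 1 - (/ 2) ^ epsilon (inhabits O) (fun n => s <= 1 - (/ 2) ^ n)).
  { apply (epsilon_spec (inhabits O) (fun n => s <= 1 - (/ 2) ^ n)). exists n. lra. }
  set (m := epsilon _ _) in *. clearbody m.
  destruct (Nat.le_ge_cases n m); [|symmetry]; apply partial_concat_stable; auto; lra.
Qed.

Lemma infinite_concat_1 D : infinite_concat_fun D 1 = x.
Proof. unfold infinite_concat_fun. destruct (Rlt_dec 1 1); [lra|auto]. Qed.

Lemma lt_1_half_pow (s : R) : s < 1 -> exists n, s < 1 - (/ 2) ^ n.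
Proof. intros Hs. destruct (half_pow_small (1 - s)) as [n Hn]; [lra|]. exists n; lra. Qed.

(** Self-similarity: removing the first loop leaves an infinite concatenation, which makes induction
    on the number of removed loops possible. *)
Lemma infinite_concat_glue D (s : R) :
  I01 s -> infinite_concat_fun D s = glue (D O) (infinite_concat_fun (shift D)) s.
Proof.
  intros [Hs0 [Hs1| ->]].
  - destruct (lt_1_half_pow s Hs1) as [n Hn]. pose proof (half_pow_le n (S n) ltac:(lia)) as Hp.
    rewrite (infinite_concat_partial (S n)) by lra. cbn. unfold glue.
    destruct (Rle_dec s (1 / 2)); auto.
    rewrite (infinite_concat_partial n); auto. cbn in Hp. lra.
  - unfold glue. destruct (Rle_dec 1 (1 / 2)); [lra|].
    replace (2 * 1 - 1) with 1 by ring. rewrite !infinite_concat_1. auto.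
Qed.

Lemma infinite_concat_maps D (U : T -> Prop) :
  U x -> (forall k s, I01 s -> U (D k s)) -> forall s, I01 s -> U (infinite_concat_fun D s).
Proof.
  intros Ux HD s [Hs0 [Hs1| ->]].
  - destruct (lt_1_half_pow s Hs1) as [n Hn]. rewrite (infinite_concat_partial n) by lra.
    apply partial_concat_maps; auto. split; lra.
  - rewrite infinite_concat_1. auto.
Qed.

Definition shrinking D : Prop :=
  forall U, is_open tau U -> U x -> exists n, forall k s, (n <= k)%nat -> I01 s -> U (D k s).

Lemma shrinking_shift D : shrinking D -> shrinking (shift D).
Proof.
  intros HD U OU Ux. destruct (HD U OU Ux) as [n Hn]. exists n. intros. apply Hn; auto.
Qed.

Lemma infinite_concat_cont_1 (n : nat) D (U : T -> Prop) :
  U x -> (forall k s, (n <= k)%nat -> I01 s -> U (D k s)) ->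
  exists del, 0 < del /\ forall s, I01 s -> Rabs (s - 1) < del -> U (infinite_concat_fun D s).
Proof.
  intros Ux. revert D. induction n as [|n IH]; intros D HD.
  - exists 1. split; [lra|]. intros s Hs _. apply infinite_concat_maps; auto.
    intros; apply HD; auto. lia.
  - destruct (IH (shift D)) as (del & Hd & H). { intros; apply HD; auto; lia. }
    pose proof (Rmin_l (1 / 2) (del / 2)). pose proof (Rmin_r (1 / 2) (del / 2)).
    (* The first bound keeps [s] beyond the first loop; the second allows for the factor 2 in
       [2 * s - 1]. *)
    exists (Rmin (1 / 2) (del / 2)). split; [apply Rmin_glb_lt; lra|].
    intros s Hs Ds. apply Rabs_def2 in Ds. rewrite infinite_concat_glue by auto. unfold glue.
    destruct (Rle_dec s (1 / 2)); [lra|]. unfold I01 in Hs. apply H.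
    + split; lra.
    + apply Rabs_def1; lra.
Qed.

Lemma infinite_concat_cont D : shrinking D -> cont_on_I tau (infinite_concat_fun D).
Proof.
  intros HD t [Ht0 [Ht1| ->]] U OU HU.
  - destruct (lt_1_half_pow t Ht1) as [n Hn]. rewrite (infinite_concat_partial n) in HU by lra.
    destruct (path_cont _ _ _ (partial_concat n D) t ltac:(lra) U OU HU) as (del & Hd & H).
    pose proof (Rmin_l (1 - (/ 2) ^ n - t) del). pose proof (Rmin_r (1 - (/ 2) ^ n - t) del).
    exists (Rmin (1 - (/ 2) ^ n - t) del). split; [apply Rmin_glb_lt; lra|].
    intros s Hs Ds. rewrite (infinite_concat_partial n).
    + apply H; auto; lra.
    + apply Rabs_def2 in Ds. lra.
  - rewrite infinite_concat_1 in HU. destruct (HD U OU HU) as [n Hn].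
    apply (infinite_concat_cont_1 n); auto.
Qed.

Definition infinite_concat D (HD : shrinking D) : path tau x x.
Proof.
  refine {| path_fun := infinite_concat_fun D |}.
  - apply infinite_concat_cont; auto.
  - rewrite (infinite_concat_partial 0) by (cbn; lra). reflexivity.
  - apply infinite_concat_1.
Defined.

Lemma infinite_concat_unfold D (HD : shrinking D) :
  path_homotopic tau (infinite_concat D HD)
    (path_comp tau (D O) (infinite_concat (shift D) (shrinking_shift D HD))).
Proof. apply path_homotopic_ext. intros s Hs. apply infinite_concat_glue. auto. Qed.

(** The common loops before [n] cancel on the left one by one; the infinite common tail after [n] is
    a single path and cancels on the right at once. *)
Lemma infinite_concat_cancel (n : nat) D D' (HD : shrinking D) (HD' : shrinking D') :
  (forall k, k <> n -> D k = D' k) ->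
  path_homotopic tau (infinite_concat D HD) (infinite_concat D' HD') ->
  path_homotopic tau (D n) (D' n).
Proof.
  revert D D' HD HD'. induction n as [|n IH]; intros D D' HD HD' E H;
    rewrite (infinite_concat_unfold D), (infinite_concat_unfold D') in H.
  - apply (path_comp_cancel_r tau _ _ (infinite_concat (shift D) (shrinking_shift D HD))).
    rewrite H. apply path_comp_proper; [reflexivity|].
    apply path_homotopic_ext. intros s _. cbn. f_equal. extensionality k. symmetry. apply E. lia.
  - rewrite (E O) in H by lia. apply path_comp_cancel_l in H.
    apply (IH (shift D) (shift D') _ _) in H; auto. intros k Hk. apply E. lia.
Qed.

(** The number [n] depends on the time only. This local constancy makes the boundary conditions of a
    coded homotopy closed in the binary sequences. *)
Lemma infinite_concat_locally_constant (s : R) :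
  I01 s -> exists n, forall D D', agree n D D' -> infinite_concat_fun D s = infinite_concat_fun D' s.
Proof.
  intros [Hs0 [Hs1| ->]].
  - destruct (lt_1_half_pow s Hs1) as [n Hn]. exists n. intros D D' E.
    rewrite !(infinite_concat_partial n) by lra. apply partial_concat_agree. auto.
  - exists O. intros. rewrite !infinite_concat_1. auto.
Qed.

End InfiniteConcatenation.

(** * Homotopy is a Suslin relation *)

(** The cut at 1 makes every natural number code a point of the unit square. *)
Definition grid (q : nat) : R * R :=
  let (a, m) := Cantor.of_nat q in let (b, c) := Cantor.of_nat m in
  (Rmin 1 (INR a / (INR c + 1)), Rmin 1 (INR b / (INR c + 1))).

Definition near (e : R) (x y : R * R) : Prop :=
  Rabs (fst x - fst y) < e /\ Rabs (snd x - snd y) < e.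

Lemma near_sym (e : R) (x y : R * R) : near e x y -> near e y x.
Proof. unfold near. rewrite (Rabs_minus_sym (fst x)), (Rabs_minus_sym (snd x)). auto. Qed.

Lemma near_le (e e' : R) (x y : R * R) : e <= e' -> near e x y -> near e' x y.
Proof. unfold near. lra. Qed.

Lemma near_triangle (e e' : R) (x y z : R * R) : near e x y -> near e' y z -> near (e + e') x z.
Proof.
  unfold near. intros [H1 H2] [H3 H4]. split.
  - replace (fst x - fst z) with ((fst x - fst y) + (fst y - fst z)) by ring.
    eapply Rle_lt_trans; [apply Rabs_triang|lra].
  - replace (snd x - snd z) with ((snd x - snd y) + (snd y - snd z)) by ring.
    eapply Rle_lt_trans; [apply Rabs_triang|lra].
Qed.

Lemma grid_I01 (q : nat) : I01 (fst (grid q)) /\ I01 (snd (grid q)).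
Proof.
  unfold grid. destruct (Cantor.of_nat q) as [a m]. destruct (Cantor.of_nat m) as [b c].
  assert (H : forall k, I01 (Rmin 1 (INR k / (INR c + 1)))).
  { intros k. split; [|apply Rmin_l]. apply Rmin_glb; [lra|].
    pose proof (pos_INR c). apply Rmult_le_pos; [apply pos_INR|].
    apply Rlt_le, Rinv_0_lt_compat. lra. }
  cbn. auto.
Qed.

Lemma fraction_below (t : R) (c : nat) : I01 t -> exists a,
  Rabs (INR a / (INR c + 1) - t) <= / (INR c + 1) /\ INR a / (INR c + 1) <= 1 /\
  (t = 0 -> INR a / (INR c + 1) = 0) /\ (t = 1 -> INR a / (INR c + 1) = 1).
Proof.
  intros [Ht0 Ht1]. pose proof (pos_INR c).
  assert (Hi : 0 < / (INR c + 1)) by (apply Rinv_0_lt_compat; lra).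
  destruct (INR_floor (t * (INR c + 1))) as [a Ha].
  { apply Rmult_le_pos; lra. }
  assert (Ec : (INR c + 1) * / (INR c + 1) = 1) by (field; lra).
  assert (L1 : INR a / (INR c + 1) <= t) by (unfold Rdiv; nra).
  assert (L2 : t <= INR a / (INR c + 1) + / (INR c + 1)) by (unfold Rdiv; nra).
  assert (L3 : 0 <= INR a / (INR c + 1)) by (apply Rmult_le_pos; [apply pos_INR|lra]).
  exists a. split; [|split; [|split]].
  - apply Rabs_le. lra.
  - lra.
  - lra.
  - intros ->. rewrite Rmult_1_l, <- !S_INR in Ha. destruct Ha as [A1 A2].
    apply INR_le in A1. apply INR_lt in A2. replace a with (S c) by lia.
    rewrite S_INR. unfold Rdiv. lra.
Qed.

(** Points on a side of the square are approximated along that side, because the boundary conditions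
    of a code are imposed at grid points only. *)
Lemma grid_dense (t u e : R) : I01 t -> I01 u -> 0 < e -> exists q, near e (grid q) (t, u) /\
  (t = 0 -> fst (grid q) = 0) /\ (t = 1 -> fst (grid q) = 1) /\
  (u = 0 -> snd (grid q) = 0) /\ (u = 1 -> snd (grid q) = 1).
Proof.
  intros Ht Hu He. destruct (exists_inv_lt e He) as [c Hc].
  destruct (fraction_below t c Ht) as (a & A1 & A2 & A3 & A4).
  destruct (fraction_below u c Hu) as (b & B1 & B2 & B3 & B4).
  exists (Cantor.to_nat (a, Cantor.to_nat (b, c))). unfold grid. rewrite !Cantor.cancel_of_to.
  rewrite !Rmin_right by auto. unfold near; cbn [fst snd]. repeat split; auto; lra.
Qed.

Lemma uniform_continuity_I2 {X : Type} (tau : topology X) (d : X -> X -> R) (H : R -> R -> X) :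
  is_metric d -> (forall U, is_open tau U <-> metric_open d U) -> cont_on_I2 tau H ->
  forall e, 0 < e -> exists del, 0 < del /\ forall t u s v, I01 t -> I01 u -> I01 s -> I01 v ->
    near del (t, u) (s, v) -> d (H t u) (H s v) < e.
Proof.
  intros Hd Htau C e He.
  assert (Hx : forall t u, exists del : posreal, I01 t -> I01 u ->
    forall s v, I01 s -> I01 v -> near (2 * del) (s, v) (t, u) -> d (H t u) (H s v) < e / 2).
  { intros t u. destruct (classic (I01 t /\ I01 u)) as [[Ht Hu]|N].
    - destruct (C t u Ht Hu (fun y => d (H t u) y < e / 2)) as (del & Hdel & HC).
      { apply metric_ball_open; auto. }
      { rewrite (proj2 (proj1 (proj2 Hd) _ _) eq_refl). lra. }
      assert (Hdel2 : 0 < del / 2) by lra.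
      exists (mkposreal _ Hdel2). intros _ _ s v Hs Hv [N1 N2]. cbn [fst snd pos] in N1, N2. unfold I01 in *.
      apply HC; lra.
    - exists (mkposreal 1 Rlt_0_1). tauto. }
  destruct (choice (fun t del => forall u, I01 t -> I01 u ->
    forall s v, I01 s -> I01 v -> near (2 * pos (del u)) (s, v) (t, u) -> d (H t u) (H s v) < e / 2))
    as [del Hdel].
  { intros t. apply (choice (fun u (del : posreal) => I01 t -> I01 u ->
    forall s v, I01 s -> I01 v -> near (2 * del) (s, v) (t, u) -> d (H t u) (H s v) < e / 2)). auto. }
  destruct (Compactness.compactness_value_2d 0 1 0 1 del) as [r Hr].
  exists r. split; [apply cond_pos|]. intros t u s v Ht Hu Hs Hv N.
  destruct (NNPP _ (Hr t u Ht Hu)) as (t' & u' & Ht' & Hu' & D1 & D2 & L).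
  destruct Hd as (_ & _ & Hsym & Htri).
  assert (N' : near (del t' u') (t, u) (t', u')) by (split; auto).
  assert (A1 : d (H t' u') (H t u) < e / 2).
  { apply (Hdel t' u'); auto. eapply near_le; [|exact N']. pose proof (cond_pos (del t' u')). lra. }
  assert (A2 : d (H t' u') (H s v) < e / 2).
  { apply (Hdel t' u'); auto. replace (2 * del t' u') with (del t' u' + del t' u') by ring.
    eapply near_triangle; [|exact N']. apply near_sym. eapply near_le; [|exact N]. auto. }
  pose proof (Htri (H t u) (H t' u') (H s v)). rewrite (Hsym (H t u) (H t' u')) in H0. lra.
Qed.

Section Closed.
Context {Y K : Type} (tau : topology Y).

Lemma prod_baire_closed_forall {J : Type} (C : J -> Y -> (nat -> K) -> Prop) :
  (forall j, prod_baire_closed tau (C j)) -> prod_baire_closed tau (fun y s => forall j, C j y s).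
Proof.
  intros H y s N. apply not_all_ex_not in N as [j Nj].
  destruct (H j y s Nj) as (U & n & OU & Uy & HU). exists U, n. repeat split; auto.
  intros y' s' Uy' E HC. apply (HU y' s'); auto.
Qed.

Lemma prod_baire_closed_and (C C' : Y -> (nat -> K) -> Prop) :
  prod_baire_closed tau C -> prod_baire_closed tau C' ->
  prod_baire_closed tau (fun y s => C y s /\ C' y s).
Proof.
  intros H H' y s N. apply not_and_or in N as [N|N].
  - destruct (H y s N) as (U & n & OU & Uy & HU). exists U, n. repeat split; auto.
    intros y' s' Uy' E [HC _]. apply (HU y' s'); auto.
  - destruct (H' y s N) as (U & n & OU & Uy & HU). exists U, n. repeat split; auto.
    intros y' s' Uy' E [_ HC]. apply (HU y' s'); auto.
Qed.

(** Suited to conditions that read finitely many coordinates of [s] and a value locally constant in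
    [y]. *)
Lemma prod_baire_closed_local (C : Y -> (nat -> K) -> Prop) :
  (forall y s, exists U n, is_open tau U /\ U y /\
     forall y' s', U y' -> agree n s' s -> C y' s' -> C y s) ->
  prod_baire_closed tau C.
Proof.
  intros H y s N. destruct (H y s) as (U & n & OU & Uy & HU). exists U, n. repeat split; auto.
  intros y' s' Uy' E HC. apply N. eauto.
Qed.
End Closed.

(** * Coding homotopies by sequences over [K] *)

Section Suslin.
Context {K X : Type} (tau : topology X) (d : X -> X -> R).
Hypothesis Hd : is_metric d.
Hypothesis Hcomplete : metric_complete d.
Hypothesis Htau : forall U, is_open tau U <-> metric_open d U.
Variable i : nat -> K.
Variable ri : K -> nat.
Hypothesis Hri : forall n, ri (i n) = n.
Variable dec : K -> X.
Hypothesis Hdec : forall x U, is_open tau U -> U x -> exists k, U (dec k).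

(* A sequence [s : nat -> K] codes a modulus of uniform continuity and, for every grid point,
   approximations of a function on the unit square. *)
Let radius (s : nat -> K) (n : nat) : R := / (INR (ri (s (Cantor.to_nat (O, n)))) + 1).
Let value (s : nat -> K) (q n : nat) : X := dec (s (Cantor.to_nat (S q, n))).

Let dtri (x y z : X) : d x z <= d x y + d y z := proj2 (proj2 (proj2 Hd)) x y z.
Let dsym (x y : X) : d x y = d y x := proj1 (proj2 (proj2 Hd)) x y.
Let d0 (x : X) : d x x = 0 := proj2 (proj1 (proj2 Hd) x x) eq_refl.

Let radius_pos s n : 0 < radius s n.
Proof. unfold radius. apply Rinv_0_lt_compat. pose proof (pos_INR (ri (s (Cantor.to_nat (O, n))))). lra. Qed.

Let radius_agree (n : nat) : exists N, forall s s', agree N s' s -> radius s' n = radius s n.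
Proof.
  exists (S (Cantor.to_nat (O, n))). intros s s' E. unfold radius. rewrite E; auto.
Qed.

Let value_agree (q n : nat) : exists N, forall s s', agree N s' s -> value s' q n = value s q n.
Proof.
  exists (S (Cantor.to_nat (S q, n))). intros s s' E. unfold value. rewrite E; auto.
Qed.

(** A value of level [n] is meant to lie within half of [(/ 2) ^ n] of the true one. Two levels then
    differ by at most [(/ 2) ^ n], and two nearby grid points by at most twice that, within the
    allowed factor 3. *)
Let coherent (s : nat -> K) : Prop :=
  (forall q n m, (n <= m)%nat -> d (value s q n) (value s q m) <= (/ 2) ^ n) /\
  (forall n q q', near (radius s n) (grid q) (grid q') -> d (value s q n) (value s q' n) <= 3 * (/ 2) ^ n).

(** Two grid points within half the radius of [(t, u)] are within the radius of each other, which
    costs 3; passing to a higher level costs 1 more. *)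
Let limit_spec (s : nat -> K) (t u : R) (x : X) : Prop :=
  forall n q, near (radius s n / 2) (grid q) (t, u) -> d (value s q n) x <= 4 * (/ 2) ^ n.

Let limit_exists (s : nat -> K) (t u : R) :
  coherent s -> I01 t -> I01 u -> exists x, limit_spec s t u x.
Proof.
  intros [CA CB] Ht Hu.
  (* The radii need not decrease with the level, so the grid point [Q n] is chosen for all levels up
     to [n] together. *)
  assert (He : forall n, exists e, 0 < e /\ forall j, (j <= n)%nat -> e <= radius s j / 2).
  { induction n as [|n (e & He & Hj)].
    - exists (radius s 0 / 2). split; [pose proof (radius_pos s 0); lra|].
      intros j Hj. replace j with O by lia. lra.
    - exists (Rmin e (radius s (S n) / 2)). split.
      + apply Rmin_glb_lt; auto. pose proof (radius_pos s (S n)); lra.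
      + intros j Hj'. destruct (Nat.eq_dec j (S n)) as [->|Nj]; [apply Rmin_r|].
        eapply Rle_trans; [apply Rmin_l|]. apply Hj. lia. }
  destruct (choice (fun n q => forall j, (j <= n)%nat -> near (radius s j / 2) (grid q) (t, u)))
    as [Q HQ].
  { intros n. destruct (He n) as (e & He0 & Hj). destruct (grid_dense t u e Ht Hu He0) as (q & Nq & _).
    exists q. intros j L. eapply near_le; [|exact Nq]. auto. }
  assert (Hk : forall n q k, (n <= k)%nat -> near (radius s n / 2) (grid q) (t, u) ->
    d (value s q n) (value s (Q k) k) <= 4 * (/ 2) ^ n).
  { intros n q k L Nq. pose proof (dtri (value s q n) (value s (Q k) n) (value s (Q k) k)).
    specialize (CA (Q k) n k L).
    assert (d (value s q n) (value s (Q k) n) <= 3 * (/ 2) ^ n); [|lra].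
    apply CB. replace (radius s n) with (radius s n / 2 + radius s n / 2) by lra.
    eapply near_triangle; [exact Nq|]. apply near_sym, HQ; auto. }
  destruct (Hcomplete (fun n => value s (Q n) n)) as [x Hx].
  { intros e He0. destruct (half_pow_small (e / 4)) as [N HN]; [lra|]. exists N.
    assert (W : forall m n, (N <= m)%nat -> (m <= n)%nat ->
       d (value s (Q m) m) (value s (Q n) n) < e).
    { intros m n L1 L2. eapply Rle_lt_trans; [apply Hk; auto|].
      pose proof (half_pow_le N m L1). lra. }
    intros m n L1 L2. destruct (Nat.le_ge_cases m n); auto. rewrite dsym. auto. }
  exists x. intros n q Nq. apply le_epsilon. intros e He0. destruct (Hx e He0) as [N HN].
  pose proof (Hk n q (n + N)%nat ltac:(lia) Nq). specialize (HN (n + N)%nat ltac:(lia)).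
  pose proof (dtri (value s q n) (value s (Q (n + N)%nat) (n + N)) x). lra.
Qed.

Let limit_unique (s : nat -> K) (t u : R) (x z : X) :
  limit_spec s t u x ->
  (forall n, exists q, near (radius s n / 2) (grid q) (t, u) /\ d (value s q n) z <= 2 * (/ 2) ^ n) ->
  x = z.
Proof.
  intros Hx Hz. apply (proj1 (proj2 Hd)). apply Rle_antisym; [|apply Hd].
  apply le_epsilon. intros e He0. destruct (half_pow_small (e / 6)) as [n Hn]; [lra|].
  destruct (Hz n) as (q & Nq & Dq). specialize (Hx n q Nq).
  pose proof (dtri x (value s q n) z). rewrite (dsym x (value s q n)) in H. lra.
Qed.

Context {Y : Type} (sigma : topology Y) (a b : X) (p q : Y -> path tau a b).
Hypothesis p_local : forall y u, I01 u -> exists V, is_open sigma V /\ V y /\ forall y', V y' -> p y' u = p y u.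
Hypothesis q_local : forall y u, I01 u -> exists V, is_open sigma V /\ V y /\ forall y', V y' -> q y' u = q y u.

Let code (y : Y) (s : nat -> K) : Prop :=
  coherent s /\
  (forall j n, fst (grid j) = 0 -> d (value s j n) (p y (snd (grid j))) <= (/ 2) ^ n) /\
  (forall j n, fst (grid j) = 1 -> d (value s j n) (q y (snd (grid j))) <= (/ 2) ^ n) /\
  (forall j n, snd (grid j) = 0 -> d (value s j n) a <= (/ 2) ^ n) /\
  (forall j n, snd (grid j) = 1 -> d (value s j n) b <= (/ 2) ^ n).

Let code_closed : prod_baire_closed sigma code.
Proof.
  assert (Hfull : is_open sigma (fun _ => True)) by apply open_full.
  repeat apply prod_baire_closed_and; repeat (apply prod_baire_closed_forall; intros ?);
    apply prod_baire_closed_local; intros y s.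
  - destruct (value_agree j j0) as [N1 E1], (value_agree j j1) as [N2 E2].
    exists (fun _ => True), (N1 + N2)%nat. split; [auto|split; [auto|]]. intros y' s' _ E.
    rewrite (E1 s s'), (E2 s s') by (intros k Hk; apply E; lia). auto.
  - destruct (value_agree j0 j) as [N1 E1], (value_agree j1 j) as [N2 E2], (radius_agree j) as [N3 E3].
    exists (fun _ => True), (N1 + N2 + N3)%nat. split; [auto|split; [auto|]]. intros y' s' _ E.
    rewrite (E1 s s'), (E2 s s'), (E3 s s') by (intros k Hk; apply E; lia). auto.
  - destruct (value_agree j j0) as [N1 E1], (p_local y (snd (grid j))) as (V & OV & Vy & HV).
    { apply grid_I01. }
    exists V, N1. split; [auto|split; [auto|]]. intros y' s' Vy' E. rewrite (E1 s s' E), HV; auto.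
  - destruct (value_agree j j0) as [N1 E1], (q_local y (snd (grid j))) as (V & OV & Vy & HV).
    { apply grid_I01. }
    exists V, N1. split; [auto|split; [auto|]]. intros y' s' Vy' E. rewrite (E1 s s' E), HV; auto.
  - destruct (value_agree j j0) as [N1 E1]. exists (fun _ => True), N1.
    split; [auto|split; [auto|]]. intros y' s' _ E. rewrite (E1 s s' E); auto.
  - destruct (value_agree j j0) as [N1 E1]. exists (fun _ => True), N1.
    split; [auto|split; [auto|]]. intros y' s' _ E. rewrite (E1 s s' E); auto.
Qed.

Let code_sound (y : Y) (s : nat -> K) : code y s -> path_homotopic tau (p y) (q y).
Proof.
  intros (Hc & C1 & C2 & C3 & C4).
  destruct (choice (fun t Hu => forall u, I01 t -> I01 u -> limit_spec s t u (Hu u))) as [H HH].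
  { intros t. apply (choice (fun u x => I01 t -> I01 u -> limit_spec s t u x)).
    intros u. destruct (classic (I01 t /\ I01 u)) as [[Ht Hu]|N].
    - destruct (limit_exists s t u Hc Ht Hu) as [x Hx]. eauto.
    - exists a. tauto. }
  assert (I0 : I01 0) by (unfold I01; lra). assert (I1 : I01 1) by (unfold I01; lra).
  (* On a vertical side the grid points stay on the side, so their values are close to [c] by the
     code and [c] varies little by continuity: the two errors give the factor 2 in
     [limit_unique]. *)
  assert (edge : forall (c : path tau a b) t, I01 t -> (t = 0 \/ t = 1) ->
    (forall j n, fst (grid j) = t -> d (value s j n) (c (snd (grid j))) <= (/ 2) ^ n) ->
    forall u, I01 u -> H t u = c u).
  { intros c t It Ht Hcj u Hu. apply (limit_unique s t u); [apply HH; auto|]. intros n.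
    destruct (path_cont _ _ _ c u Hu (fun y => d (c u) y < (/ 2) ^ n)) as (del & Hdel & HC).
    { apply metric_ball_open; auto. }
    { rewrite d0. apply half_pow_pos. }
    pose proof (radius_pos s n).
    destruct (grid_dense t u (Rmin del (radius s n / 2)) It Hu) as (j & Nj & F0 & F1 & _).
    { apply Rmin_glb_lt; lra. }
    exists j. split; [eapply near_le; [apply Rmin_r|exact Nj]|].
    assert (Hj : fst (grid j) = t) by (destruct Ht; subst; auto).
    specialize (Hcj j n Hj).
    assert (d (c u) (c (snd (grid j))) < (/ 2) ^ n).
    { apply HC; [apply grid_I01|]. destruct Nj as [_ Nj]. cbn in Nj.
      pose proof (Rmin_l del (radius s n / 2)). lra. }
    pose proof (dtri (value s j n) (c (snd (grid j))) (c u)) as Tr.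
    rewrite (dsym (c (snd (grid j)))) in Tr. lra. }
  exists H. split; [|split].
  - intros t u Ht Hu U OU HU. destruct (proj1 (Htau U) OU _ HU) as (e & He & HeU).
    (* Both limit values lie within [4 * (/ 2) ^ n] of the value at one common grid point. *)
    destruct (half_pow_small (e / 8)) as [n Hn]; [lra|]. pose proof (radius_pos s n).
    exists (radius s n / 4). split; [lra|]. intros v w Hv Hw D1 D2. apply HeU.
    destruct (grid_dense t u (radius s n / 4) Ht Hu) as (j & Nj & _); [lra|].
    assert (A1 : d (value s j n) (H t u) <= 4 * (/ 2) ^ n).
    { apply HH; auto. eapply near_le; [|exact Nj]. lra. }
    assert (A2 : d (value s j n) (H v w) <= 4 * (/ 2) ^ n).
    { apply HH; auto. replace (radius s n / 2) with (radius s n / 4 + radius s n / 4) by lra.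
      eapply near_triangle; [exact Nj|]. apply near_sym. split; auto. }
    pose proof (dtri (H t u) (value s j n) (H v w)) as Tr. rewrite (dsym (H t u) (value s j n)) in Tr. lra.
  - intros u Hu. split; [apply (edge (p y))|apply (edge (q y))]; auto.
  - intros t Ht. split.
    + apply (limit_unique s t 0); [apply HH; auto|]. intros n. pose proof (radius_pos s n).
      destruct (grid_dense t 0 (radius s n / 2) Ht I0) as (j & Nj & _ & _ & F0 & _); [lra|].
      exists j. split; auto. specialize (C3 j n (F0 eq_refl)). pose proof (half_pow_pos n). lra.
    + apply (limit_unique s t 1); [apply HH; auto|]. intros n. pose proof (radius_pos s n).
      destruct (grid_dense t 1 (radius s n / 2) Ht I1) as (j & Nj & _ & _ & _ & F1); [lra|].
      exists j. split; auto. specialize (C4 j n (F1 eq_refl)). pose proof (half_pow_pos n). lra.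
Qed.

Let code_complete (y : Y) : path_homotopic tau (p y) (q y) -> exists s, code y s.
Proof.
  intros (H & C & H1 & H2).
  destruct (choice (fun n m => forall t u v w, I01 t -> I01 u -> I01 v -> I01 w ->
    near (/ (INR m + 1)) (t, u) (v, w) -> d (H t u) (H v w) < (/ 2) ^ n)) as [m Hm].
  { intros n. destruct (uniform_continuity_I2 tau d H Hd Htau C _ (half_pow_pos n))
      as (del & Hdel & HC).
    destruct (exists_inv_lt del Hdel) as [m Hm]. exists m. intros t u v w Ht Hu Hv Hw N.
    apply HC; auto. eapply near_le; [|exact N]. lra. }
  set (h := fun j => H (fst (grid j)) (snd (grid j))).
  destruct (choice (fun l k =>
    (forall n, Cantor.of_nat l = (O, n) -> k = i (m n)) /\
    (forall j n, Cantor.of_nat l = (S j, n) -> d (h j) (dec k) < (/ 2) ^ (S n)))) as [s Hs].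
  { intros l. destruct (Cantor.of_nat l) as [[|j] n].
    - exists (i (m n)). split; [|discriminate]. intros n' E. injection E as ->. auto.
    - destruct (Hdec (h j) (fun y => d (h j) y < (/ 2) ^ (S n))) as [k Hk].
      { apply metric_ball_open; auto. }
      { rewrite d0. apply half_pow_pos. }
      exists k. split; [discriminate|]. intros j' n' E. injection E as -> ->. auto. }
  assert (Er : forall n, radius s n = / (INR (m n) + 1)).
  { intros n. unfold radius. rewrite (proj1 (Hs _) n), Hri; auto. apply Cantor.cancel_of_to. }
  assert (Ev : forall j n, d (h j) (value s j n) < (/ 2) ^ (S n)).
  { intros j n. apply (proj2 (Hs _) j n), Cantor.cancel_of_to. }
  assert (Ev' : forall j n x, h j = x -> d (value s j n) x <= (/ 2) ^ n).
  { intros j n x <-. specialize (Ev j n). rewrite dsym. cbn in Ev. pose proof (half_pow_pos n). lra. }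
  exists s. split; [split|].
  - intros j n n' L. pose proof (Ev j n) as V1. pose proof (Ev j n') as V2.
    pose proof (half_pow_le n n' L). pose proof (dtri (value s j n) (h j) (value s j n')) as Tr.
    rewrite (dsym _ (h j)) in Tr. cbn in V1, V2. lra.
  - intros n j j' N. rewrite Er in N. pose proof (Ev j n) as V1. pose proof (Ev j' n) as V2.
    assert (d (h j) (h j') < (/ 2) ^ n).
    { apply Hm; try apply grid_I01. destruct (grid j), (grid j'). exact N. }
    pose proof (dtri (value s j n) (h j) (value s j' n)) as T1.
    pose proof (dtri (h j) (h j') (value s j' n)) as T2.
    rewrite (dsym _ (h j)) in T1. cbn in V1, V2. pose proof (half_pow_pos n). lra.
  - repeat split; intros j n E; apply Ev'; unfold h; rewrite E; try apply H1; try apply H2;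
      apply grid_I01.
Qed.

Lemma path_homotopic_suslin : k_suslin K sigma (fun y => path_homotopic tau (p y) (q y)).
Proof.
  exists code. split; [apply code_closed|]. intros y. split.
  - apply code_complete.
  - intros [s Hs]. apply (code_sound y s Hs).
Qed.
End Suslin.

(** * Category in sequence spaces *)

Definition metric_topology {T : Type} (d : T -> T -> R) : topology T.
Proof.
  refine {| is_open := metric_open d |}.
  - intros x _. exists 1. split; [lra|auto].
  - intros U V HU HV x [Ux Vx]. destruct (HU x Ux) as (e & He & H), (HV x Vx) as (e' & He' & H').
    pose proof (Rmin_l e e'). pose proof (Rmin_r e e').
    exists (Rmin e e'). split; [apply Rmin_glb_lt; auto|]. intros y Hy. split; [apply H|apply H']; lra.
  - intros F HF x (U & FU & Ux). destruct (HF U FU x Ux) as (e & He & H). exists e. split; eauto.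
Defined.

Lemma agree_sym {B : Type} (n : nat) (a b : nat -> B) : agree n a b -> agree n b a.
Proof. intros H k Hk. symmetry. auto. Qed.

Lemma agree_trans {B : Type} (n : nat) (a b c : nat -> B) : agree n a b -> agree n b c -> agree n a c.
Proof. intros H H' k Hk. rewrite H; auto. Qed.

Lemma agree_le {B : Type} (n m : nat) (a b : nat -> B) : (n <= m)%nat -> agree m a b -> agree n a b.
Proof. intros L H k Hk. apply H. lia. Qed.

Section Sequences.
Context {B : Type}.
Implicit Types a b c : nat -> B.

Definition seq_dist a b : R :=
  epsilon (inhabits 0) (fun r => (a = b /\ r = 0) \/ exists n, agree n a b /\ a n <> b n /\ r = (/ 2) ^ n).

Lemma seq_dist_spec a b :
  (a = b /\ seq_dist a b = 0) \/ exists n, agree n a b /\ a n <> b n /\ seq_dist a b = (/ 2) ^ n.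
Proof.
  apply (epsilon_spec (inhabits 0)
    (fun r => (a = b /\ r = 0) \/ exists n, agree n a b /\ a n <> b n /\ r = (/ 2) ^ n)).
  destruct (classic (a = b)) as [E|N]; [eauto|].
  destruct (first_difference a b N) as (n & H1 & H2). eauto 6.
Qed.

Lemma seq_dist_agree a b n : seq_dist a b <= (/ 2) ^ n <-> agree n a b.
Proof.
  destruct (seq_dist_spec a b) as [[-> ->]|(m & H1 & H2 & ->)].
  - split; [intros _ k _; auto|]. intros _. apply Rlt_le, half_pow_pos.
  - split.
    + intros L. apply agree_le with m; auto. apply Nat.nlt_ge. intros Hlt.
      pose proof (half_pow_le (S m) n Hlt). cbn in H. pose proof (half_pow_pos m). lra.
    + intros H. apply half_pow_le. apply Nat.nlt_ge. auto.
Qed.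

Lemma seq_dist_metric : is_metric seq_dist.
Proof.
  assert (P : forall a b, 0 <= seq_dist a b).
  { intros a b. destruct (seq_dist_spec a b) as [[_ ->]|(m & _ & _ & ->)]; [lra|].
    apply Rlt_le, half_pow_pos. }
  split; [auto|split; [|split]].
  - intros a b. destruct (seq_dist_spec a b) as [[-> ->]|(m & H1 & H2 & ->)]; [tauto|].
    pose proof (half_pow_pos m). split; [lra|]. intros ->. congruence.
  - assert (H : forall a b, seq_dist a b <= seq_dist b a).
    { intros a b. destruct (seq_dist_spec b a) as [[-> E]|(m & H1 & H2 & ->)]; [lra|].
      apply seq_dist_agree, agree_sym; auto. }
    intros a b. apply Rle_antisym; auto.
  - intros a b c. pose proof (P a b). pose proof (P b c).
    destruct (seq_dist_spec a b) as [[-> E]|(n & Hab & _ & ->)]; [lra|].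
    destruct (seq_dist_spec b c) as [[-> E]|(m & Hbc & _ & ->)].
    { replace (seq_dist a c) with (seq_dist a c + 0) by ring. apply Rplus_le_compat; auto.
      apply seq_dist_agree; auto. }
    pose proof (half_pow_pos n). pose proof (half_pow_pos m).
    destruct (Nat.le_ge_cases n m).
    + apply Rle_trans with ((/ 2) ^ n); [|lra]. apply seq_dist_agree.
      apply agree_trans with b; auto. apply agree_le with m; auto.
    + apply Rle_trans with ((/ 2) ^ m); [|lra]. apply seq_dist_agree.
      apply agree_trans with b; auto. apply agree_le with n; auto.
Qed.

Definition seq_topology : topology (nat -> B) := metric_topology seq_dist.

Lemma cylinder_open n a : is_open seq_topology (agree n a).
Proof.
  intros b Hb. exists ((/ 2) ^ n). split; [apply half_pow_pos|]. intros c Hc.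
  apply agree_trans with b; auto. apply seq_dist_agree. lra.
Qed.

Lemma open_cylinder (U : (nat -> B) -> Prop) a :
  is_open seq_topology U -> U a -> exists n, forall b, agree n a b -> U b.
Proof.
  intros OU Ua. destruct (OU a Ua) as (e & He & H). destruct (half_pow_small e He) as [n Hn].
  exists n. intros b Hb. apply H. apply seq_dist_agree in Hb. lra.
Qed.

Lemma seq_dist_complete : metric_complete seq_dist.
Proof.
  intros u Hu.
  destruct (choice (fun n N => forall m k, (N <= m)%nat -> (N <= k)%nat -> agree n (u m) (u k)))
    as [N HN].
  { intros n. destruct (Hu _ (half_pow_pos n)) as [N HN]. exists N. intros m k L1 L2.
    apply seq_dist_agree. specialize (HN m k L1 L2). lra. }
  (* Coordinate [n] is settled once prefixes of length [S n] agree. *)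
  exists (fun n => u (N (S n)) n). intros e He. destruct (half_pow_small e He) as [n Hn].
  exists (N n). intros m Hm. apply Rle_lt_trans with ((/ 2) ^ n); auto. apply seq_dist_agree.
  intros k Hk. set (M := (m + N (S k))%nat).
  transitivity (u M k).
  - apply (HN n); auto; unfold M; lia.
  - apply (HN (S k)); unfold M; lia.
Qed.

(** A form of nowhere density ready for recursive constructions: each cylinder has a subcylinder
    missing [M]. *)
Definition cylinder_nowhere_dense (M : (nat -> B) -> Prop) : Prop :=
  forall a n, exists b m, (n <= m)%nat /\ agree n a b /\ forall c, agree m b c -> ~ M c.

Lemma nowhere_dense_cylinder (M : (nat -> B) -> Prop) :
  nowhere_dense seq_topology M -> cylinder_nowhere_dense M.
Proof.
  intros HM a n. apply NNPP; intros N. apply (HM a).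
  exists (agree n a). split; [apply cylinder_open|split; [intros k _; auto|]].
  intros b Hb U OU Ub. destruct (open_cylinder U b OU Ub) as [k Hk].
  apply NNPP; intros N'. apply N. exists b, (n + k)%nat. split; [lia|split; auto].
  intros c Hc Mc. apply N'. exists c. split; auto. apply Hk. apply agree_le with (n + k)%nat; auto. lia.
Qed.
End Sequences.

Lemma testbit_prefix (w : nat -> bool) (n : nat) :
  exists k, forall i, (i < n)%nat -> Nat.testbit k i = w i.
Proof.
  revert w. induction n as [|n IH]; intros w.
  - exists O. lia.
  - destruct (IH (fun i => w (S i))) as [k Hk]. exists (2 * k + Nat.b2n (w O))%nat.
    intros [|i] Hi.
    + apply Nat.testbit_0_r.
    + rewrite Nat.testbit_succ_r. apply Hk. lia.
Qed.

Definition bit_pairs (k i : nat) : bool * bool := (Nat.testbit k (2 * i), Nat.testbit k (2 * i + 1)).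

Lemma bit_pairs_polish : polish (@seq_topology (bool * bool)).
Proof.
  split.
  - exists seq_dist. split; [apply seq_dist_metric|split; [apply seq_dist_complete|]]. reflexivity.
  - exists (fun a => exists k, a = bit_pairs k). split.
    + intros a U OU Ua. destruct (open_cylinder U a OU Ua) as [n Hn].
      destruct (testbit_prefix (fun i => if Nat.even i then fst (a (i / 2)) else snd (a (i / 2)))%nat
        (2 * n)%nat) as [k Hk].
      exists (bit_pairs k). split; [|eauto]. apply Hn. intros i Hi. unfold bit_pairs.
      rewrite !Hk by lia.
      replace (Nat.even (2 * i)) with true by (symmetry; apply Nat.even_spec; exists i; auto).
      replace (Nat.even (2 * i + 1)) with false.
      2:{ symmetry. rewrite <- Nat.negb_odd. apply Bool.negb_false_iff, Nat.odd_spec. exists i; auto. }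
      replace ((2 * i) / 2)%nat with i.
      2:{ apply Nat.div_unique with O; lia. }
      replace ((2 * i + 1) / 2)%nat with i.
      2:{ apply Nat.div_unique with 1%nat; lia. }
      destruct (a i); auto.
    + exists (fun a => epsilon (inhabits O) (fun k => a = bit_pairs k)).
      intros a b Ha Hb E.
      pose proof (epsilon_spec (inhabits O) (fun k => a = bit_pairs k) Ha) as Ea.
      pose proof (epsilon_spec (inhabits O) (fun k => b = bit_pairs k) Hb) as Eb.
      cbv beta in Ea, Eb. rewrite Ea, Eb, E. reflexivity.
Qed.

Definition pair_seq (a b : nat -> bool) (n : nat) : bool * bool := (a n, b n).

Lemma pair_seq_eta (y : nat -> bool * bool) :
  pair_seq (fun n => fst (y n)) (fun n => snd (y n)) = y.
Proof. extensionality n. unfold pair_seq. destruct (y n); auto. Qed.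

Lemma pair_seq_agree (n : nat) (a a' b b' : nat -> bool) :
  agree n a a' -> agree n b b' -> agree n (pair_seq a b) (pair_seq a' b').
Proof. intros H H' k Hk. unfold pair_seq. rewrite H, H' by auto. auto. Qed.

(** * Fusion along a tree of cylinders: Baire category and Mycielski's theorem *)

Section Fusion.
Variable M : nat -> (nat -> bool * bool) -> Prop.
Hypothesis HM : forall k, cylinder_nowhere_dense (M k).

Let avoids (k m : nat) (a b : nat -> bool) : Prop := forall c, agree m (pair_seq a b) c -> ~ M k c.

Let avoids_mono (k m m' : nat) (a b a' b' : nat -> bool) :
  (m <= m')%nat -> agree m a a' -> agree m b b' -> avoids k m a b -> avoids k m' a' b'.
Proof.
  intros L Ha Hb H c Hc. apply H. apply agree_trans with (pair_seq a' b').
  - apply pair_seq_agree; auto.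
  - apply agree_le with m'; auto.
Qed.

(** The requirements are met one at a time; lengthening the prefixes later keeps those already met.
    As [i] and [j] differ, both nodes can be extended independently. *)
Let avoid_list (P : list (nat * (nat * nat))) (s : nat -> nat -> bool) (n : nat) :
  exists s' m, (n <= m)%nat /\ (forall i, agree n (s i) (s' i)) /\
    forall k i j, In (k, (i, j)) P -> i <> j -> avoids k m (s' i) (s' j).
Proof.
  induction P as [|[k [i j]] P IH].
  - exists s, n. split; auto. split; [intros i k _; auto|]. intros k i j [].
  - destruct IH as (s1 & m1 & L1 & E1 & A1).
    destruct (HM k (pair_seq (s1 i) (s1 j)) m1) as (b & m2 & L2 & E2 & A2).
    set (s2 := fun l => if Nat.eqb l i then (fun x => fst (b x))
                        else if Nat.eqb l j then (fun x => snd (b x)) else s1 l).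
    assert (E3 : forall l, agree m1 (s1 l) (s2 l)).
    { intros l x Hx. unfold s2. specialize (E2 x Hx). unfold pair_seq in E2.
      destruct (Nat.eqb_spec l i) as [->|_]; [rewrite <- E2; auto|].
      destruct (Nat.eqb_spec l j) as [->|_]; [rewrite <- E2; auto|]. auto. }
    exists s2, m2. split; [lia|split].
    + intros l. apply agree_trans with (s1 l); auto. apply agree_le with m1; auto.
    + intros k' i' j' [E|H] N.
      * injection E as <- <- <-. intros c Hc. apply A2. apply agree_trans with (pair_seq (s2 i) (s2 j)); auto.
        replace (pair_seq (s2 i) (s2 j)) with b; [intros x _; auto|].
        unfold s2. rewrite Nat.eqb_refl. destruct (Nat.eqb_spec j i); [congruence|].
        rewrite Nat.eqb_refl. symmetry; apply pair_seq_eta.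
      * apply (avoids_mono k' m1 m2 (s1 i') (s1 j')); auto.
Qed.

(* At stage [n] node [j] of the tree carries the cylinder of length [l n] around [s n j]; the parent of
   node [j] of stage [n + 1] is node [parent j] of stage [n]. *)
Lemma fusion (P : nat -> list (nat * (nat * nat))) (parent : nat -> nat) (s0 : nat -> nat -> bool) (l0 : nat) :
  exists c : (nat -> nat) -> nat -> bool,
    (forall b, (forall n, b n = parent (b (S n))) -> agree l0 (s0 (b O)) (c b)) /\
    (forall b b' n k, (forall n, b n = parent (b (S n))) -> (forall n, b' n = parent (b' (S n))) ->
       In (k, (b (S n), b' (S n))) (P n) -> b (S n) <> b' (S n) -> ~ M k (pair_seq (c b) (c b'))).
Proof.
  destruct (choice (fun (x : nat * ((nat -> nat -> bool) * nat)) (y : (nat -> nat -> bool) * nat) =>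
     (snd (snd x) < snd y)%nat /\
     (forall j, agree (snd (snd x)) (fst (snd x) (parent j)) (fst y j)) /\
     (forall k i j, In (k, (i, j)) (P (fst x)) -> i <> j -> avoids k (snd y) (fst y i) (fst y j))))
    as [step Hstep].
  { intros [n [s l]]. destruct (avoid_list (P n) (fun j => s (parent j)) (S l)) as (s' & m & L & E & A).
    exists (s', m). cbn. split; [lia|split; auto]. intros j. apply agree_le with (S l); auto. }
  set (st := fix st n := match n with O => (s0, l0) | S n => step (n, st n) end).
  set (s := fun n => fst (st n)). set (l := fun n => snd (st n)).
  assert (Hl : forall n, (l n < l (S n))%nat) by (intros n; apply (Hstep (n, st n))).
  assert (Hs : forall n j, agree (l n) (s n (parent j)) (s (S n) j)) by (intros n; apply (Hstep (n, st n))).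
  assert (Ha : forall n k i j, In (k, (i, j)) (P n) -> i <> j -> avoids k (l (S n)) (s (S n) i) (s (S n) j))
    by (intros n; apply (Hstep (n, st n))).
  assert (Hln : forall n, (n <= l n)%nat).
  { induction n as [|n IH]; [lia|]. specialize (Hl n). lia. }
  assert (Hll : forall n m, (n <= m)%nat -> (l n <= l m)%nat).
  { induction 1 as [|m _ IH]; auto. specialize (Hl m). lia. }
  assert (Hb : forall b, (forall n, b n = parent (b (S n))) ->
    forall n m, (n <= m)%nat -> agree (l n) (s n (b n)) (s m (b m))).
  { intros b Hb n. induction 1 as [|m L IH]; [intros k _; auto|].
    apply agree_trans with (s m (b m)); auto. apply agree_le with (l m); auto.
    rewrite (Hb m). apply Hs. }
  (* Stage [S i] fixes at least [S i] coordinates, hence coordinate [i]. *)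
  set (c := fun (b : nat -> nat) i => s (S i) (b (S i)) i).
  assert (Hc : forall b, (forall n, b n = parent (b (S n))) -> forall n, agree (l n) (s n (b n)) (c b)).
  { intros b H n i Hi. unfold c. destruct (Nat.le_ge_cases n (S i)).
    - apply (Hb b H); auto.
    - symmetry. apply (Hb b H); auto. }
  exists c. split.
  - intros b H. apply (Hc b H O).
  - intros b b' n k H H' I N. apply (Ha n k _ _ I N).
    apply pair_seq_agree; apply Hc; auto.
Qed.

(** A degenerate fusion: nodes 0 and 1 are their own parents and carry the two components of the
    pair, and stage [k] avoids [M k]. *)
Lemma baire_category (y : nat -> bool * bool) (n : nat) :
  exists c, agree n y c /\ forall k, ~ M k c.
Proof.
  destruct (fusion (fun n => [(n, (0, 1)%nat)]) (fun j => j)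
    (fun j => match j with O => fun i => fst (y i) | _ => fun i => snd (y i) end) n) as (c & C1 & C2).
  exists (pair_seq (c (fun _ => O)) (c (fun _ => 1%nat))). split.
  - rewrite <- (pair_seq_eta y) at 1. apply pair_seq_agree.
    + apply (C1 (fun _ => O)). auto.
    + apply (C1 (fun _ => 1%nat)). auto.
  - intros k. apply (C2 (fun _ => O) (fun _ => 1%nat) k k); cbn; auto.
Qed.

Lemma mycielski :
  exists c : (nat -> bool) -> nat -> bool,
    forall u v, u <> v -> forall k, ~ M k (pair_seq (c u) (c v)).
Proof.
  (* Halving the node number gives the full binary tree. Stage [n] separates all nodes of level
     [S n] with respect to the first [S n] sets. *)
  destruct (fusion (fun n => list_prod (seq 0 (S n)) (list_prod (seq 0 (2 ^ S n)) (seq 0 (2 ^ S n))))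
    (fun j => (j / 2)%nat) (fun _ _ => true) O) as (c & _ & C).
  set (branch := fun (u : nat -> bool) => fix b n :=
    match n with O => O | S n => (2 * b n + Nat.b2n (u n))%nat end).
  assert (Bp : forall u n, branch u n = (branch u (S n) / 2)%nat).
  { intros u n. apply Nat.div_unique with (Nat.b2n (u n)); [|reflexivity]. destruct (u n); cbn; lia. }
  assert (Bb : forall u n, (branch u n < 2 ^ n)%nat).
  { intros u n. induction n as [|n IH]; cbn; [lia|]. destruct (u n); cbn; lia. }
  exists (fun u => c (branch u)). intros u v N k.
  destruct (first_difference u v N) as (m & _ & Hm).
  assert (D : forall n, (m <= n)%nat -> branch u (S n) <> branch v (S n)).
  { induction 1 as [|n _ IH].
    - change (2 * branch u m + Nat.b2n (u m) <> 2 * branch v m + Nat.b2n (v m))%nat.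
      destruct (u m), (v m); try (destruct Hm; reflexivity); cbn [Nat.b2n]; lia.
    - intros E. apply IH. rewrite (Bp u (S n)), (Bp v (S n)), E. auto. }
  (* By stage [m + k] the branches have parted, at [m], and [M k] is among the sets treated. *)
  apply (C (branch u) (branch v) (m + k)%nat k); auto.
  - apply in_prod; [apply in_seq; lia|].
    apply in_prod; apply in_seq; split; try lia; apply Bb.
  - apply D. lia.
Qed.
End Fusion.

(* If [E] were not meager it would be comeager in a cylinder, hence so would be its image under flipping
   a coordinate not fixed by the cylinder; a point of the intersection yields two equivalent sequences
   that differ in exactly this coordinate. *)
Lemma continuum_many_classes (E : (nat -> bool) -> (nat -> bool) -> Prop) :
  (forall a b, E a b -> E b a) -> (forall a b c, E a b -> E b c -> E a c) ->
  (forall a b n, (forall k, k <> n -> a k = b k) -> a n <> b n -> ~ E a b) ->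
  baire_property seq_topology (fun y : nat -> bool * bool => E (fun n => fst (y n)) (fun n => snd (y n))) ->
  exists c : (nat -> bool) -> nat -> bool, forall u v, u <> v -> ~ E (c u) (c v).
Proof.
  intros Esym Etrans Eflip (O & OO & M & HM & HA).
  assert (HM' : forall k, cylinder_nowhere_dense (M k)) by (intros; apply nowhere_dense_cylinder; auto).
  destruct (classic (exists y, O y)) as [[y Oy]|N].
  - exfalso. destruct (open_cylinder O y OO Oy) as [n Hn].
    set (flip := fun (y : nat -> bool * bool) k =>
      if Nat.eqb k n then (negb (fst (y k)), snd (y k)) else y k).
    assert (flipK : forall y, flip (flip y) = y).
    { intros z. extensionality k. unfold flip. destruct (Nat.eqb k n); auto.
      cbn. rewrite Bool.negb_involutive. destruct (z k); auto. }
    assert (flip_agree : forall m a b, agree m a b -> agree m (flip a) (flip b)).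
    { intros m a b H k Hk. unfold flip. rewrite (H k Hk). auto. }
    (* Even indices list the sets [M k] and odd ones their preimages under the flip, so one point
       avoids both families. *)
    destruct (baire_category (fun k z => M (Nat.div2 k) (if Nat.even k then z else flip z))) with (y := y) (n := n)
      as (c & Hc & Mc).
    { intros k a m. destruct (Nat.even k).
      - apply HM'.
      - destruct (HM' (Nat.div2 k) (flip a) m) as (b & m' & L & H1 & H2).
        exists (flip b), m'. split; auto. split.
        + rewrite <- (flipK a). auto.
        + intros z Hz. apply H2. rewrite <- (flipK b). auto. }
    assert (Ac : forall z, O z -> (forall k, ~ M k z) -> E (fun n => fst (z n)) (fun n => snd (z n))).
    { intros z Oz Mz. apply NNPP; intros NE. destruct (HA z) as [k Hk].
      - split; [auto|tauto].
      - exact (Mz k Hk). }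
    assert (E1 : E (fun k => fst (c k)) (fun k => snd (c k))).
    { apply Ac; auto. intros k. specialize (Mc (2 * k)%nat). cbv beta in Mc.
      replace (Nat.even (2 * k)) with true in Mc by (symmetry; apply Nat.even_spec; exists k; auto).
      rewrite Nat.div2_double in Mc. auto. }
    assert (E2 : E (fun k => fst (flip c k)) (fun k => snd (flip c k))).
    { apply Ac.
      - apply Hn. intros k Hk. unfold flip. destruct (Nat.eqb_spec k n); [lia|]. auto.
      - intros k. specialize (Mc (S (2 * k))). cbv beta in Mc.
        replace (Nat.even (S (2 * k))) with false in Mc.
        2:{ symmetry. rewrite <- Nat.negb_odd. apply Bool.negb_false_iff, Nat.odd_spec. exists k; lia. }
        rewrite Nat.div2_succ_double in Mc. auto. }
    replace (fun k => snd (flip c k)) with (fun k => snd (c k)) in E2.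
    2:{ extensionality k. unfold flip. destruct (Nat.eqb k n); auto. }
    (* Both first components are related to the same second component, hence to each other. *)
    apply (Eflip (fun k => fst (c k)) (fun k => fst (flip c k)) n); eauto.
    + intros k Hk. unfold flip. destruct (Nat.eqb_spec k n); [congruence|auto].
    + unfold flip. rewrite Nat.eqb_refl. cbn. destruct (fst (c n)); discriminate.
  (* With [O] empty the sets [M k] cover the whole relation. *)
  - destruct (mycielski M HM') as [c Hc]. exists c. intros u v Huv Euv.
    destruct (HA (pair_seq (c u) (c v))) as [k Hk].
    + split; [left; auto|]. intros [_ H]. apply N. eauto.
    + exact (Hc u v Huv k Hk).
Qed.

(** * Essential loops *)

Lemma open_of_nbhds {T : Type} (tau : topology T) (U : T -> Prop) :
  (forall x, U x -> exists V, is_open tau V /\ V x /\ forall y, V y -> U y) -> is_open tau U.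
Proof.
  intros H.
  replace U with (fun x => exists V, (is_open tau V /\ forall y, V y -> U y) /\ V x).
  - apply (open_union _ tau (fun V => is_open tau V /\ forall y, V y -> U y)). tauto.
  - extensionality x. apply propositional_extensionality. split.
    + intros (V & [_ VU] & Vx). auto.
    + intros Ux. destruct (H x Ux) as (V & OV & Vx & VU). eauto.
Qed.

(** The path component of [a] and its complement are both open. *)
Lemma connected_path_connected {T : Type} (tau : topology T) (a b : T) :
  connected tau -> locally_path_connected tau -> exists p : path tau a b, True.
Proof.
  intros C L.
  assert (Hp : forall x y g, is_path tau g x y -> exists p : path tau x y, True).
  { intros x y g (Cg & G0 & G1). exists {| path_fun := g; path_cont := Cg; path_0 := G0; path_1 := G1 |}. auto. }
  set (U := fun x => exists p : path tau a x, True).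
  assert (HU : forall x, exists V, is_open tau V /\ V x /\ forall y, V y -> (U y <-> U x)).
  { intros x. destruct (L x (fun _ => True) (open_full _ tau) Logic.I) as (V & OV & Vx & _ & HV).
    exists V. split; [auto|split; [auto|]]. intros y Vy.
    destruct (HV x y Vx Vy) as (g & Hg & _). destruct (Hp x y g Hg) as [p _].
    split; intros [q _].
    - exists (path_comp tau q (path_rev tau p)). auto.
    - exists (path_comp tau q p). auto. }
  destruct (C U (fun x => ~ U x)) as [N|N].
  - apply open_of_nbhds. intros x Ux. destruct (HU x) as (V & OV & Vx & H).
    exists V. split; [auto|split; [auto|]]. intros y Vy. apply H; auto.
  - apply open_of_nbhds. intros x Ux. destruct (HU x) as (V & OV & Vx & H).
    exists V. split; [auto|split; [auto|]]. intros y Vy. rewrite H; auto.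
  - intros x. apply classic.
  - tauto.
  - exfalso. apply (N a). exists (const_path tau a). auto.
  - apply NNPP, N.
Qed.

Lemma loop_homotopic_refl {T : Type} (tau : topology T) (x0 : T) (g : R -> T) :
  is_loop tau x0 g -> loop_homotopic tau x0 g g.
Proof. intros Hg. apply (path_homotopic_ext tau (loop_path tau x0 g Hg) (loop_path tau x0 g Hg)). auto. Qed.

Lemma loop_homotopic_sym {T : Type} (tau : topology T) (x0 : T) (g h : R -> T) :
  is_loop tau x0 g -> is_loop tau x0 h -> loop_homotopic tau x0 g h -> loop_homotopic tau x0 h g.
Proof. intros Hg Hh. apply (path_homotopic_sym tau (loop_path tau x0 g Hg) (loop_path tau x0 h Hh)). Qed.

Lemma loop_homotopic_trans {T : Type} (tau : topology T) (x0 : T) (g h k : R -> T) :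
  is_loop tau x0 g -> is_loop tau x0 h -> is_loop tau x0 k ->
  loop_homotopic tau x0 g h -> loop_homotopic tau x0 h k -> loop_homotopic tau x0 g k.
Proof.
  intros Hg Hh Hk. apply (path_homotopic_trans tau (loop_path tau x0 g Hg)
    (loop_path tau x0 h Hh) (loop_path tau x0 k Hk)).
Qed.

(** * At most continuum many classes of loops, and equality from a large family *)

Section UpperBound.
Context {K X : Type} (tau : topology X) (d : X -> X -> R).
Hypothesis Hd : is_metric d.
Hypothesis Htau : forall U, is_open tau U <-> metric_open d U.
Variable dec : K -> X.
Hypothesis Hdec : forall x U, is_open tau U -> U x -> exists k, U (dec k).
Variable j : K -> nat -> bool.
Hypothesis Hj : inj j.

Let metric_eq (x y : X) : (forall e, 0 < e -> d x y < e) -> x = y.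
Proof.
  intros H. apply (proj1 (proj2 Hd)). apply Rle_antisym; [|apply Hd].
  apply le_epsilon. intros e He. specialize (H e He). lra.
Qed.

Let point_code : exists f : X -> nat -> bool, inj f.
Proof.
  destruct (nat_power_injection j Hj) as [g Hg].
  destruct (choice (fun x s => forall n, d x (dec (s n)) < (/ 2) ^ n)) as [s Hs].
  { intros x. apply (choice (fun n k => d x (dec k) < (/ 2) ^ n)). intros n.
    apply (Hdec x (fun y => d x y < (/ 2) ^ n)).
    - apply metric_ball_open; auto.
    - rewrite (proj2 (proj1 (proj2 Hd) x x) eq_refl). apply half_pow_pos. }
  exists (fun x => g (s x)). intros x y E. apply Hg in E. apply metric_eq. intros e He.
  destruct (half_pow_small (e / 2)) as [n Hn]; [lra|].
  pose proof (Hs x n) as A. pose proof (Hs y n) as B. rewrite <- E in B.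
  destruct Hd as (_ & _ & Hsym & Htri).
  pose proof (Htri x (dec (s x n)) y). rewrite (Hsym y) in B. lra.
Qed.

(** A loop is determined by its values on a countable dense set of times, here the first coordinates
    of the grid points. *)
Let loop_code (x0 : X) :
  exists f : (R -> X) -> nat -> bool, forall g h, is_loop tau x0 g -> is_loop tau x0 h ->
    f g = f h -> loop_homotopic tau x0 g h.
Proof.
  destruct point_code as [f Hf]. destruct (nat_power_injection f Hf) as [F HF].
  exists (fun g => F (fun q => g (fst (grid q)))). intros g h Hg Hh E. apply HF in E.
  apply (path_homotopic_ext tau (loop_path tau x0 g Hg) (loop_path tau x0 h Hh)).
  intros t Ht. cbn. apply metric_eq. intros e He.
  assert (Hball : forall k : R -> X, is_loop tau x0 k -> exists del, 0 < del /\
    forall s, I01 s -> Rabs (s - t) < del -> d (k t) (k s) < e / 2).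
  { intros k [Ck _]. apply (Ck t Ht (fun y => d (k t) y < e / 2)).
    - apply metric_ball_open; auto.
    - rewrite (proj2 (proj1 (proj2 Hd) _ _) eq_refl). lra. }
  destruct (Hball g Hg) as (d1 & Hd1 & B1). destruct (Hball h Hh) as (d2 & Hd2 & B2).
  destruct (grid_dense t t (Rmin d1 d2) Ht Ht) as (q & [Nq _] & _).
  { apply Rmin_glb_lt; auto. }
  cbn [fst] in Nq. pose proof (Rmin_l d1 d2). pose proof (Rmin_r d1 d2).
  specialize (B1 (fst (grid q)) (proj1 (grid_I01 q)) ltac:(lra)).
  specialize (B2 (fst (grid q)) (proj1 (grid_I01 q)) ltac:(lra)).
  apply (f_equal (fun k => k q)) in E. cbv beta in E. rewrite <- E in B2.
  destruct Hd as (_ & _ & Hsym & Htri).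
  pose proof (Htri (g t) (g (fst (grid q))) (h t)). rewrite (Hsym (h t)) in B2. lra.
Qed.

Lemma pi1_continuum_of_family (x0 : X) (l : (nat -> bool) -> R -> X) :
  (forall u, is_loop tau x0 (l u)) ->
  (forall u v, u <> v -> ~ loop_homotopic tau x0 (l u) (l v)) ->
  pi1_card_continuum tau x0.
Proof.
  intros Hl Hne. destruct (loop_code x0) as [c Hc].
  destruct (class_invariant_code (is_loop tau x0) (loop_homotopic tau x0) c) as [f Hf];
    eauto using loop_homotopic_refl, loop_homotopic_sym, loop_homotopic_trans.
  destruct dedekind_cut_injection as [b Hb]. destruct ternary_injection as [t Ht].
  (* The values of the class invariant on loops stand for the fundamental group; [Q] embeds in the
     reals, and the family [l] embeds the reals in [Q]. *)
  set (Q := {s : nat -> bool | exists g, is_loop tau x0 g /\ f g = s}).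
  destruct (schroeder_bernstein (fun q : Q => t (proj1_sig q))
     (fun r => exist _ (f (l (b r))) (ex_intro _ (l (b r)) (conj (Hl _) eq_refl)) : Q)) as (h & h1 & h2).
  { intros [s Hs] [s' Hs'] E. apply Ht in E. cbn in E. subst s'. f_equal. apply proof_irrelevance. }
  { intros r r' E. apply (f_equal (@proj1_sig _ _)) in E. cbn in E.
    apply Hb. apply NNPP. intros N. apply (Hne _ _ N). apply Hf; auto. }
  (* The bijection needs a proof of membership in [Q]; proof irrelevance makes its value depend on
     [f g] alone. A function that is not a loop may share its code with a loop. *)
  destruct (choice (fun g r => forall H, h (exist _ (f g) H) = r)) as [F HF].
  { intros g. destruct (classic (is_loop tau x0 g)) as [Hg|Ng].
    - exists (h (exist _ (f g) (ex_intro _ g (conj Hg eq_refl)))). intros H.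
      do 2 f_equal. apply proof_irrelevance.
    - destruct (classic (exists g', is_loop tau x0 g' /\ f g' = f g)) as [H|H].
      + exists (h (exist _ (f g) H)). intros H'. do 2 f_equal. apply proof_irrelevance.
      + exists 0. tauto. }
  exists F. split.
  - intros g k Hg Hk.
    rewrite <- (HF g (ex_intro _ g (conj Hg eq_refl))), <- (HF k (ex_intro _ k (conj Hk eq_refl))).
    rewrite (Hf g k Hg Hk). split.
    + intros E. f_equal. apply eq_sig_hprop; [intros; apply proof_irrelevance|]. exact E.
    + intros E. apply h1 in E. apply (f_equal (@proj1_sig _ _)) in E. exact E.
  - intros r. destruct (h2 r) as [[s (g & Hg & <-)] <-]. exists g. split; auto.
Qed.
End UpperBound.

Section EssentialLoops.
Context {K X : Type} (tau : topology X) (d : X -> X -> R).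
Hypothesis Hd : is_metric d.
Hypothesis Hcomplete : metric_complete d.
Hypothesis Htau : forall U, is_open tau U <-> metric_open d U.
Variable i : nat -> K.
Hypothesis Hi : inj i.
Variable dec : K -> X.
Hypothesis Hdec : forall x U, is_open tau U -> U x -> exists k, U (dec k).
Hypothesis HBP : BP K.
Variable x : X.
Hypothesis Hx : forall U, is_open tau U -> U x -> exists p : path tau x x,
  (forall t, I01 t -> U (p t)) /\ ~ path_homotopic tau p (const_path tau x).

Lemma continuum_many_loops : exists l : (nat -> bool) -> path tau x x,
  forall u v, u <> v -> ~ path_homotopic tau (l u) (l v).
Proof.
  destruct (choice (fun n (p : path tau x x) => (forall t, I01 t -> d x (p t) < (/ 2) ^ n) /\
    ~ path_homotopic tau p (const_path tau x))) as [gam Hgam].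
  { intros n. apply (Hx (fun y => d x y < (/ 2) ^ n)).
    - apply metric_ball_open; auto.
    - rewrite (proj2 (proj1 (proj2 Hd) x x) eq_refl). apply half_pow_pos. }
  (* A digit 0 leaves a constant loop in its slot, so changing one digit changes exactly one slot,
     as [infinite_concat_cancel] requires. *)
  set (D := fun (a : nat -> bool) n => if a n then gam n else const_path tau x).
  assert (HD : forall a, shrinking tau x (D a)).
  { intros a U OU Ux. destruct (proj1 (Htau U) OU x Ux) as (e & He & HU).
    destruct (half_pow_small e He) as [n Hn]. exists n. intros k s Hk Hs. unfold D.
    destruct (a k); [|exact Ux]. apply HU. pose proof (proj1 (Hgam k) s Hs).
    pose proof (half_pow_le n k Hk). lra. }
  set (L := fun a => infinite_concat tau x (D a) (HD a)).
  destruct (inj_left_inverse i O Hi) as [ri Hri].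
  assert (Hlocal : forall f : bool * bool -> bool, forall (y : nat -> bool * bool) u, I01 u ->
    exists V, is_open seq_topology V /\ V y /\
      forall y', V y' -> L (fun n => f (y' n)) u = L (fun n => f (y n)) u).
  { intros f y u Hu. destruct (infinite_concat_locally_constant tau x u Hu) as [n Hn].
    exists (agree n y). split; [apply cylinder_open|split; [intros k _; auto|]].
    intros y' Hy'. apply Hn. intros k Hk. unfold D. rewrite (Hy' k Hk). auto. }
  destruct (continuum_many_classes (fun a b => path_homotopic tau (L a) (L b))) as [c Hc].
  - intros a b. apply path_homotopic_sym.
  - intros a b c. apply path_homotopic_trans.
  (* Cancellation leaves a homotopy between [gam n] and the constant loop. *)
  - intros a b n E N H. unfold L in H. apply (infinite_concat_cancel tau x n) in H.
    + unfold D in H. apply (proj2 (Hgam n)). destruct (a n), (b n); try congruence.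
      symmetry. auto.
    + intros k Hk. unfold D. rewrite (E k Hk). auto.
  - apply HBP; [apply bit_pairs_polish|].
    apply (path_homotopic_suslin tau d Hd Hcomplete Htau i ri Hri dec Hdec seq_topology x x
      (fun y => L (fun n => fst (y n))) (fun y => L (fun n => snd (y n)))).
    + apply (Hlocal fst).
    + apply (Hlocal snd).
  - exists (fun u => L (c u)). exact Hc.
Qed.
End EssentialLoops.

(* The cardinal kappa is represented as the cardinality of a type K. *)
Theorem theorem4p1 (K : Type)
  (K_infinite : exists i : nat -> K, forall m n, i m = i n -> m = n)
  (K_le_c : exists j : K -> R, forall a b, j a = j b -> a = b)
  (K_lt_c : ~ exists j : R -> K, forall a b, j a = j b -> a = b)
  (HBP : BP K)
  (X : Type) (tau : topology X)
  (Xconn : connected tau) (Xlpc : locally_path_connected tau)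
  (Xpol : k_polish K tau)
  (x0 : X) :
  pi1_card_le K tau x0 \/ pi1_card_continuum tau x0.
Proof.
  destruct K_infinite as [i Hi]. destruct K_le_c as [j Hj].
  destruct Xpol as [(d & Hd & Hcomplete & Htau) Hsep].
  destruct (separable_decode tau x0 Hsep) as [dec Hdec].
  destruct (classic (forall x, exists U, is_open tau U /\ U x /\
    forall p : path tau x x, (forall t, I01 t -> U (p t)) -> path_homotopic tau p (const_path tau x)))
    as [Hsimple|N].
  - left. destruct (list_injection K i Hi) as [e He].
    apply (pi1_card_le_of_simple tau d Hd Htau Xlpc i Hi dec Hdec e He Hsimple).
  - right. apply not_all_ex_not in N as [x Nx].
    destruct (continuum_many_loops tau d Hd Hcomplete Htau i Hi dec Hdec HBP x) as [l Hl].
    { intros U OU Ux. apply NNPP. intros N. apply Nx. exists U. repeat split; auto.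
      intros p Hp. apply NNPP. intros Np. apply N. eauto. }
    destruct (connected_path_connected tau x0 x Xconn Xlpc) as [r _].
    destruct dedekind_cut_injection as [b Hb].
    (* The essential loops live at [x]; conjugation by the path [r] carries them to [x0] and can be
       cancelled. *)
    apply (pi1_continuum_of_family tau d Hd Htau dec Hdec (fun k => b (j k))) with
      (l := fun u => path_comp tau (path_comp tau r (l u)) (path_rev tau r)).
    + intros a a' E. apply Hj, Hb, E.
    + intros u. apply path_is_loop.
    + intros u v Huv H. apply (Hl u v Huv). apply (path_comp_cancel_l tau r).
      apply (path_comp_cancel_r tau _ _ (path_rev tau r)). exact H.
Qed.
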